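(* Let $H$ be a Hopf algebra over a field $k$ with bijective antipode. Suppose that $A$ is a finite-dimensional quasi-Frobenius right coideal subalgebra of $H$. Then $H$ is left flat over $A$ if and only if $H$ is right flat over $A$. In this case $H$ is faithfully flat over $A$ on both sides.
   Context: A right coideal subalgebra of $H$ is a subalgebra $A\subset H$ with $\Delta(A)\subset A\otimes H$, where $\Delta$ is the comultiplication. $H$ is left (right) (faithfully) flat over $A$ if it is (faithfully) flat as a left (right) $A$-module under multiplication in $H$. A finite-dimensional algebra is quasi-Frobenius if it is selfinjective (injective as a left and as a right module over itself). *)

(* Defs.v *)
From HB Require Import structures.
From mathcomp Require Import all_boot all_algebra.
From mathcomp Require Import boolp.
From mathcomp Require freeg.

Set Implicit Arguments.
Unset Strict Implicit.
Unset Printing Implicit Defensive.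

Import GRing.Theory.
Import Quotient.Exports.
Local Open Scope ring_scope.
Local Open Scope quotient_scope.

(* The balanced product of M and N for a right action [ract] and a left action
   [lact] of R: the free abelian group on M * N modulo the subgroup generated
   by the usual relators. It serves both for the tensor product of a right and
   a left module over a ring and for that of two modules over a commutative
   ring, where the right action is the left one. *)
Section BalancedProduct.
Import freeg.

Variables (R : Type) (M N : zmodType).
Variables (ract : M -> R -> M) (lact : R -> N -> N).

Local Notation F := {freeg (M * N)%type / int}.
Local Notation "m &* n" := (<< (m, n) >> : F) (at level 40).

Inductive tens_relator : F -> Prop :=
  | tens_relator_addl m m' n :
      tens_relator ((m + m') &* n - (m &* n + m' &* n))
  | tens_relator_addr m n n' :
      tens_relator (m &* (n + n') - (m &* n + m &* n'))
  | tens_relator_act m r n :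
      tens_relator (ract m r &* n - m &* lact r n).

Definition tens_relations : {pred F} := fun x =>
  `[< forall S : {pred F}, zmod_closed S ->
        (forall y, tens_relator y -> y \in S) -> x \in S >].

Fact tens_relations_zmod_closed : zmod_closed tens_relations.
Proof.
split=> [|x y]; rewrite /tens_relations !unfold_in.
  by apply/asboolP => S [S0 _] _.
move=> /asboolP Sx /asboolP Sy; apply/asboolP => S Scl Srel.
by case: (Scl) => _; apply; [apply: Sx | apply: Sy].
Qed.

HB.instance Definition _ :=
  GRing.isZmodClosed.Build F tens_relations tens_relations_zmod_closed.

Definition btens : Type := {ideal_quot tens_relations}.
HB.instance Definition _ := GRing.Zmodule.on btens.

Definition btens_pure (m : M) (n : N) : btens :=
  \pi_({ideal_quot tens_relations}) (m &* n).

Fact tens_relator_eq x y :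
  tens_relator (x - y) -> \pi x = \pi y :> {ideal_quot tens_relations}.
Proof.
move=> rxy; apply/eqP; rewrite -Quotient.idealrBE.
by apply/asboolP => S _; apply.
Qed.

Lemma btens_pureDl m m' n :
  btens_pure (m + m') n = btens_pure m n + btens_pure m' n.
Proof.
rewrite /btens_pure (tens_relator_eq (tens_relator_addl m m' n)).
exact: (raddfD (\pi_({ideal_quot tens_relations}))).
Qed.

Lemma btens_pureDr m n n' :
  btens_pure m (n + n') = btens_pure m n + btens_pure m n'.
Proof.
rewrite /btens_pure (tens_relator_eq (tens_relator_addr m n n')).
exact: (raddfD (\pi_({ideal_quot tens_relations}))).
Qed.

Lemma btens_pure_act m r n : btens_pure (ract m r) n = btens_pure m (lact r n).
Proof. exact: (tens_relator_eq (tens_relator_act m r n)). Qed.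

Lemma btens_pure_zmod_morphism n : zmod_morphism (btens_pure^~ n).
Proof.
move=> m m'; apply: (addIr (btens_pure m' n)).
by rewrite -btens_pureDl !subrK.
Qed.

Lemma btens_ind (P : btens -> Prop) :
  (forall m n, P (btens_pure m n)) -> (forall x y, P x -> P y -> P (x + y)) ->
  forall t, P t.
Proof.
move=> Ppure PD t.
have pN m n : btens_pure (- m) n = - btens_pure m n.
  by apply/eqP; rewrite -addr_eq0 -btens_pureDl addNr -(subrr 0)
    btens_pure_zmod_morphism subrr.
have P0 : P 0.
  by rewrite -(subrr (btens_pure 0 0)) -pN; apply: PD; apply: Ppure.
have PpureN m n : P (- btens_pure m n) by rewrite -pN; apply: Ppure.
have PMn x k : P x -> P (x *+ k).
  by move=> Px; elim: k => [|k IHk]; rewrite ?mulr0n // mulrS; apply: PD.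
rewrite -[t](reprK (t : {ideal_quot tens_relations})).
elim/freeg_ind_dom0: (repr _) => [|k [m n] D _ _ PDD].
  by rewrite (raddf0 (\pi_({ideal_quot tens_relations}))).
rewrite (raddfD (\pi_({ideal_quot tens_relations}))); apply: PD => //.
have -> : << k *g (m, n) >> = (m &* n) *~ k by rewrite freegU_mulz intz.
rewrite (raddfMz (\pi_({ideal_quot tens_relations}))).
case: k => k; first exact: (PMn _ k (Ppure m n)).
by rewrite NegzE mulrNz -mulNrz; exact: (PMn _ k.+1 (PpureN m n)).
Qed.

Definition balanced (W : zmodType) (f : M -> N -> W) : Prop :=
  [/\ forall m m' n, f (m + m') n = f m n + f m' n,
      forall m n n', f m (n + n') = f m n + f m n' &
      forall m r n, f (ract m r) n = f m (lact r n)].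

(* The additive map sending [btens_pure m n] to [f m n]; only meaningful for
   a balanced [f]: see [btens_liftE] and [btens_liftD]. *)
Definition btens_lift (W : zmodType) (f : M -> N -> W) (t : btens) : W :=
  fglift (fun p : M * N => f p.1 p.2 : zmodule W)
    (repr (t : {ideal_quot tens_relations})).

Section Lift.
Variables (W : zmodType) (f : M -> N -> W).
Hypothesis fbal : balanced f.

Let g : F -> W := fglift (fun p : M * N => f p.1 p.2 : zmodule W).

Let gB x y : g (x - y) = g x - g y.
Proof. exact: (@lift_is_additive int _ (zmodule W)). Qed.

Let g0 : g 0 = 0.
Proof. by have := gB 0 0; rewrite !subrr. Qed.

Let gD x y : g (x + y) = g x + g y.
Proof.
have gN z : g (- z) = - g z by have := gB 0 z; rewrite g0 !sub0r.
by have := gB x (- y); rewrite gN !opprK.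
Qed.

Let gU m n : g (m &* n) = f m n.
Proof. by rewrite /g liftU /= scale1r. Qed.

Fact btens_lift_pi x : btens_lift f (\pi_({ideal_quot tens_relations}) x) = g x.
Proof.
set y := repr (\pi_({ideal_quot tens_relations}) x).
have : y - x \in tens_relations by rewrite Quotient.idealrBE reprK.
move=> /asboolP/(_ [pred z | g z == 0]) /= H.
apply/eqP; rewrite -subr_eq0 -[X in X == _](gB y x); apply: H.
  split=> [|u v]; rewrite !inE; first by rewrite g0.
  by move=> /eqP u0 /eqP v0; rewrite gB u0 v0 subrr.
case: fbal => fDl fDr fA.
by move=> _ [m m' n|m n n'|m r n]; rewrite inE gB ?gD !gU ?fDl ?fDr ?fA subrr.
Qed.

Lemma btens_liftE m n : btens_lift f (btens_pure m n) = f m n.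
Proof. by rewrite btens_lift_pi gU. Qed.

Lemma btens_liftD x y :
  btens_lift f (x + y) = btens_lift f x + btens_lift f y.
Proof.
rewrite -[x](reprK (x : {ideal_quot tens_relations})).
rewrite -[y](reprK (y : {ideal_quot tens_relations})).
rewrite -(raddfD (\pi_({ideal_quot tens_relations}))).
by rewrite !btens_lift_pi gD.
Qed.

End Lift.

End BalancedProduct.

Definition btens_map (R R' : Type) (M N M' N' : zmodType)
    (ract : M -> R -> M) (lact : R -> N -> N)
    (ract' : M' -> R' -> M') (lact' : R' -> N' -> N')
    (f : M -> M') (g : N -> N') : btens ract lact -> btens ract' lact' :=
  btens_lift (fun m n => btens_pure ract' lact' (f m) (g n)).
Arguments btens_map {R R' M N M' N' ract lact ract' lact'} f g t.

Section TensorModules.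
Variables (k : comPzRingType) (M N : lmodType k).

Definition tens : Type :=
  btens (fun (m : M) (c : k) => c *: m) (fun (c : k) (n : N) => c *: n).
HB.instance Definition _ := GRing.Zmodule.on tens.

Definition tens_pure (m : M) (n : N) : tens := btens_pure _ _ m n.

Definition bilinear_fun (W : lmodType k) (f : M -> N -> W) : Prop :=
  (forall m, linear (f m)) /\ (forall n, linear (f^~ n)).

Definition tens_lift (W : zmodType) (f : M -> N -> W) : tens -> W :=
  btens_lift f.

Lemma tens_ind (P : tens -> Prop) :
  (forall m n, P (tens_pure m n)) -> (forall x y, P x -> P y -> P (x + y)) ->
  forall t, P t.
Proof. exact: btens_ind. Qed.

Lemma tens_pureDl m m' n : tens_pure (m + m') n = tens_pure m n + tens_pure m' n.
Proof. exact: btens_pureDl. Qed.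

Lemma tens_pureDr m n n' : tens_pure m (n + n') = tens_pure m n + tens_pure m n'.
Proof. exact: btens_pureDr. Qed.

Lemma tens_pureZ m c n : tens_pure (c *: m) n = tens_pure m (c *: n).
Proof. exact: btens_pure_act. Qed.

Definition tens_scale (c : k) : tens -> tens :=
  tens_lift (fun m n => tens_pure (c *: m) n).

Fact tens_scale_balanced c :
  balanced (fun (m : M) (c : k) => c *: m) (fun (c : k) (n : N) => c *: n)
    (fun m n => tens_pure (c *: m) n).
Proof.
split=> [m m' n|m n n'|m r n]; first by rewrite scalerDr tens_pureDl.
  exact: tens_pureDr.
by rewrite scalerA mulrC -scalerA tens_pureZ.
Qed.

Fact tens_scaleE c m n : tens_scale c (tens_pure m n) = tens_pure (c *: m) n.
Proof. exact: (btens_liftE (tens_scale_balanced c)). Qed.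

Fact tens_scaleDr c : {morph tens_scale c : x y / x + y}.
Proof. exact: (btens_liftD (tens_scale_balanced c)). Qed.

Fact tens_scaleA a b t : tens_scale a (tens_scale b t) = tens_scale (a * b) t.
Proof.
elim/tens_ind: t => [m n|x y IHx IHy]; first by rewrite !tens_scaleE scalerA.
by rewrite !tens_scaleDr IHx IHy.
Qed.

Fact tens_scale1 : left_id 1 tens_scale.
Proof.
elim/tens_ind => [m n|x y IHx IHy]; first by rewrite tens_scaleE scale1r.
by rewrite tens_scaleDr IHx IHy.
Qed.

Fact tens_scaleDl t : {morph tens_scale^~ t : a b / a + b}.
Proof.
move=> a b; elim/tens_ind: t => [m n|x y IHx IHy].
  by rewrite !tens_scaleE scalerDl tens_pureDl.
by rewrite !tens_scaleDr IHx IHy addrACA.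
Qed.

HB.instance Definition _ := GRing.Zmodule_isLmodule.Build k tens
  tens_scaleA tens_scale1 tens_scaleDr tens_scaleDl.

Lemma tens_pureZl c m n : tens_pure (c *: m) n = c *: tens_pure m n.
Proof. by rewrite -tens_scaleE. Qed.

Lemma tens_pureZr c m n : tens_pure m (c *: n) = c *: tens_pure m n.
Proof. by rewrite -tens_pureZ tens_pureZl. Qed.

Section Lift.
Variables (W : lmodType k) (f : M -> N -> W).
Hypothesis fbil : bilinear_fun f.

Fact bilinear_balanced :
  balanced (fun (m : M) (c : k) => c *: m) (fun (c : k) (n : N) => c *: n) f.
Proof.
case: fbil => fr fl.
have frD m : {morph f m : x y / x + y}.
  by move=> x y; rewrite -[x in LHS]scale1r fr scale1r.
have flD n : {morph f^~ n : x y / x + y}.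
  by move=> x y; rewrite -[x in LHS]scale1r fl scale1r.
have fr0 m : f m 0 = 0 by apply: (addIr (f m 0)); rewrite -frD !add0r.
have fl0 n : f 0 n = 0 by apply: (addIr (f 0 n)); rewrite -flD !add0r.
split=> [m m' n|m n n'|m c n]; [exact: flD | exact: frD |].
by rewrite -[c *: m]addr0 fl fl0 -[c *: n]addr0 fr fr0.
Qed.

Lemma tens_liftE m n : tens_lift f (tens_pure m n) = f m n.
Proof. exact: (btens_liftE bilinear_balanced). Qed.

Lemma tens_lift_linear : linear (tens_lift f).
Proof.
have tD := btens_liftD bilinear_balanced; rewrite -/(tens_lift f) in tD.
move=> c x y; rewrite tD; congr (_ + _).
elim/tens_ind: x => [m n|u v IHu IHv]; last first.
  by rewrite scalerDr !tD !scalerDr IHu IHv.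
rewrite -tens_pureZl !tens_liftE.
case: fbil => _ fl; have fl0 : f 0 n = 0.
  by have := fl n 1 0 0; rewrite !scale1r addr0 => /esym/eqP;
    rewrite -subr_eq0 addrK => /eqP.
by have := fl n c m 0; rewrite !addr0 fl0 addr0.
Qed.

End Lift.

End TensorModules.

Section TensorAlgebra.
Variables (k : comPzRingType) (A B : algType k).
Local Notation T := (tens A B).

Definition tens_one : T := tens_pure 1 1.

Definition tens_mul (s t : T) : T :=
  tens_lift (fun a b => tens_lift (fun a' b' => tens_pure (a * a') (b * b')) t) s.

Fact tens_mul_bilinear_r a b :
  bilinear_fun (fun a' b' => tens_pure (a * a') (b * b') : T).
Proof.
split=> [a' c x y|b' c x y]; rewrite mulrDr -scalerAr.
  by rewrite tens_pureDr tens_pureZr.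
by rewrite tens_pureDl tens_pureZl.
Qed.

Fact tens_mul_bilinear_l (t : T) :
  bilinear_fun
    (fun a b => tens_lift (fun a' b' => tens_pure (a * a') (b * b') : T) t).
Proof.
have tL a b := tens_lift_linear (tens_mul_bilinear_r a b).
split=> [a c x y|b c x y]; elim/tens_ind: t => [m n|u v IHu IHv].
- by rewrite !(tens_liftE (tens_mul_bilinear_r _ _)) mulrDl -scalerAl
    tens_pureDr tens_pureZr.
- have lD w : {morph tens_lift (fun a' b' => tens_pure (a * a') (w * b') : T)
    : u v / u + v}.
    by move=> u' v'; rewrite -[u' in LHS]scale1r tL scale1r.
  by rewrite !lD IHu IHv scalerDr addrACA.
- by rewrite !(tens_liftE (tens_mul_bilinear_r _ _)) mulrDl -scalerAl
    tens_pureDl tens_pureZl.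
have lD w : {morph tens_lift (fun a' b' => tens_pure (w * a') (b * b') : T)
  : u v / u + v}.
  by move=> u' v'; rewrite -[u' in LHS]scale1r tL scale1r.
by rewrite !lD IHu IHv scalerDr addrACA.
Qed.

Fact tens_mulE a b a' b' :
  tens_mul (tens_pure a b) (tens_pure a' b') = tens_pure (a * a') (b * b').
Proof.
rewrite /tens_mul (tens_liftE (tens_mul_bilinear_l _)).
exact: (tens_liftE (tens_mul_bilinear_r _ _)).
Qed.

Fact tens_mulDl : left_distributive tens_mul +%R.
Proof.
move=> s s' t; rewrite /tens_mul -[s in LHS]scale1r.
by rewrite (tens_lift_linear (tens_mul_bilinear_l t)) scale1r.
Qed.

Fact tens_mulDr : right_distributive tens_mul +%R.
Proof.
move=> s t t'; elim/tens_ind: s => [a b|u v IHu IHv]; last first.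
  by rewrite !tens_mulDl IHu IHv addrACA.
rewrite /tens_mul !(tens_liftE (tens_mul_bilinear_l _)) -[t in LHS]scale1r.
by rewrite (tens_lift_linear (tens_mul_bilinear_r a b)) scale1r.
Qed.

Fact tens_mulA : associative tens_mul.
Proof.
move=> s t u; elim/tens_ind: s => [a b|s s' IHs IHs']; last first.
  by rewrite !tens_mulDl IHs IHs'.
elim/tens_ind: t => [a' b'|t t' IHt IHt']; last first.
  by rewrite !(tens_mulDl, tens_mulDr) IHt IHt'.
elim/tens_ind: u => [a'' b''|u u' IHu IHu']; last first.
  by rewrite !tens_mulDr IHu IHu'.
by rewrite !tens_mulE !mulrA.
Qed.

Fact tens_mul1 : left_id tens_one tens_mul.
Proof.
elim/tens_ind => [a b|u u' IHu IHu']; first by rewrite tens_mulE !mul1r.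
by rewrite tens_mulDr IHu IHu'.
Qed.

Fact tens_mulr1 : right_id tens_one tens_mul.
Proof.
elim/tens_ind => [a b|u u' IHu IHu']; first by rewrite tens_mulE !mulr1.
by rewrite tens_mulDl IHu IHu'.
Qed.

HB.instance Definition _ := GRing.Zmodule_isPzRing.Build T
  tens_mulA tens_mul1 tens_mulr1 tens_mulDl tens_mulDr.

Lemma tens_pure_mul a b a' b' :
  (tens_pure a b : T) * tens_pure a' b' = tens_pure (a * a') (b * b').
Proof. exact: tens_mulE. Qed.

End TensorAlgebra.

Definition tens_map (k : comPzRingType) (M N M' N' : lmodType k)
    (f : M -> M') (g : N -> N') : tens M N -> tens M' N' :=
  btens_map f g.

Definition tens_assoc (k : comPzRingType) (L M N : lmodType k) :
    tens (tens L M) N -> tens L (tens M N) :=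
  tens_lift (fun t n => tens_lift (fun l m => tens_pure l (tens_pure m n)) t).

(* The multiplication on [tens H H] is the componentwise one, as given by
   [tens_pure_mul]. *)
HB.mixin Record isHopfAlgebra (k : fieldType) H of GRing.Algebra k H := {
  comul : H -> tens H H;
  counit : H -> k;
  antipode : H -> H;
  comul_linear : linear comul;
  comul_monoid_morphism : monoid_morphism comul;
  counit_linear : scalar counit;
  counit_monoid_morphism : monoid_morphism counit;
  antipode_linear : linear antipode;
  comulA : forall h,
    tens_assoc (tens_map comul idfun (comul h)) =
      tens_map idfun comul (comul h);
  comul_counitl : forall h,
    tens_lift (fun x y => counit x *: y) (comul h) = h;
  comul_counitr : forall h,
    tens_lift (fun x y => counit y *: x) (comul h) = h;
  antipodel : forall h,
    tens_lift (fun x y => antipode x * y) (comul h) = (counit h)%:A;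
  antipoder : forall h,
    tens_lift (fun x y => x * antipode y) (comul h) = (counit h)%:A
}.

#[short(type="hopfAlgType")]
HB.structure Definition HopfAlgebra (k : fieldType) :=
  { H of isHopfAlgebra k H & GRing.Algebra k H }.

Definition finite_dimensional (k : fieldType) (V : lmodType k) : Prop :=
  exists n : nat, inhabited (Vector.axiom n V).

(* The image of A (x) H in H (x) H is taken along the inclusion [val] of A; as k
   is a field, this map is injective. *)
Definition right_coideal (k : fieldType) (H : hopfAlgType k) (P : pred H)
    (A : subAlgType P) : Prop :=
  forall a : A, exists t : tens A H,
    tens_map (val : A -> H) idfun t = comul (val a).

(* Right modules over R are left modules over the converse ring R^c. *)
Definition module_tens (R : pzRingType) (M : lmodType R^c) (N : lmodType R) :=
  btens (fun (m : M) (r : R) => (r : R^c) *: m) (fun (r : R) (n : N) => r *: n).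

Definition exact_at (U V W : zmodType) (f : U -> V) (g : V -> W) : Prop :=
  forall v, g v = 0 <-> exists u, f u = v.

Section Flatness.
Variable R : pzRingType.

Definition tensl_map (M : lmodType R) (N N' : lmodType R^c) (f : N -> N') :
    module_tens N M -> module_tens N' M := btens_map f idfun.

Definition tensr_map (M : lmodType R^c) (N N' : lmodType R) (f : N -> N') :
    module_tens M N -> module_tens M N' := btens_map idfun f.

Definition flat_left_module (M : lmodType R) : Prop :=
  forall (N1 N2 N3 : lmodType R^c)
    (f : {linear N1 -> N2}) (g : {linear N2 -> N3}),
  exact_at f g -> exact_at (tensl_map (M := M) f) (tensl_map (M := M) g).

Definition faithfully_flat_left_module (M : lmodType R) : Prop :=
  forall (N1 N2 N3 : lmodType R^c)
    (f : {linear N1 -> N2}) (g : {linear N2 -> N3}),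
  exact_at f g <-> exact_at (tensl_map (M := M) f) (tensl_map (M := M) g).

Definition flat_right_module (M : lmodType R^c) : Prop :=
  forall (N1 N2 N3 : lmodType R)
    (f : {linear N1 -> N2}) (g : {linear N2 -> N3}),
  exact_at f g -> exact_at (tensr_map (M := M) f) (tensr_map (M := M) g).

Definition faithfully_flat_right_module (M : lmodType R^c) : Prop :=
  forall (N1 N2 N3 : lmodType R)
    (f : {linear N1 -> N2}) (g : {linear N2 -> N3}),
  exact_at f g <-> exact_at (tensr_map (M := M) f) (tensr_map (M := M) g).

Definition injective_module (Q : lmodType R) : Prop :=
  forall (M N : lmodType R) (i : {linear M -> N}) (f : {linear M -> Q}),
  injective i -> exists g : {linear N -> Q}, g \o i =1 f.

End Flatness.

Definition selfinjective (R : pzRingType) : Prop :=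
  injective_module (R^o : lmodType R) /\
  injective_module ((R^c)^o : lmodType R^c).

Definition quasi_frobenius (k : fieldType) (A : algType k) : Prop :=
  finite_dimensional A /\ selfinjective A.

Section RestrictionOfScalars.
Variables (A H : pzRingType) (f : {rmorphism A -> H}).

(* H as a left, resp. right, A-module under multiplication in H along f. *)
Definition left_restriction : Type := let _ := f in H.
HB.instance Definition _ := GRing.Zmodule.copy left_restriction H.

Definition right_restriction : Type := let _ := f in H.
HB.instance Definition _ := GRing.Zmodule.copy right_restriction H.

Definition left_act (a : A) (h : left_restriction) : left_restriction :=
  f a * (h : H).

Definition right_act (a : A^c) (h : right_restriction) : right_restriction :=
  (h : H) * f a.

Fact left_actA a b h : left_act a (left_act b h) = left_act (a * b) h.
Proof. by rewrite /left_act rmorphM mulrA. Qed.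
Fact left_act1 : left_id 1 left_act.
Proof. by move=> h; rewrite /left_act rmorph1 mul1r. Qed.
Fact left_actDr : right_distributive left_act +%R.
Proof. by move=> a x y; rewrite /left_act mulrDr. Qed.
Fact left_actDl h : {morph left_act^~ h : a b / a + b}.
Proof. by move=> a b; rewrite /left_act rmorphD mulrDl. Qed.
HB.instance Definition _ := GRing.Zmodule_isLmodule.Build A left_restriction
  left_actA left_act1 left_actDr left_actDl.

Fact right_actA a b h : right_act a (right_act b h) = right_act (a * b) h.
Proof. by rewrite /right_act -mulrA -rmorphM. Qed.
Fact right_act1 : left_id 1 right_act.
Proof. by move=> h; rewrite /right_act rmorph1 mulr1. Qed.
Fact right_actDr : right_distributive right_act +%R.
Proof. by move=> a x y; rewrite /right_act mulrDl. Qed.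
Fact right_actDl h : {morph right_act^~ h : a b / a + b}.
Proof. by move=> a b; rewrite /right_act rmorphD mulrDr. Qed.
HB.instance Definition _ := GRing.Zmodule_isLmodule.Build A^c right_restriction
  right_actA right_act1 right_actDr right_actDl.

End RestrictionOfScalars.

Section OverSubalgebra.
Variables (k : fieldType) (H : algType k) (P : pred H) (A : subAlgType P).

Definition left_flat_over : Prop :=
  flat_left_module (left_restriction (val : {rmorphism A -> H})).
Definition right_flat_over : Prop :=
  flat_right_module (right_restriction (val : {rmorphism A -> H})).
Definition left_faithfully_flat_over : Prop :=
  faithfully_flat_left_module (left_restriction (val : {rmorphism A -> H})).
Definition right_faithfully_flat_over : Prop :=
  faithfully_flat_right_module (right_restriction (val : {rmorphism A -> H})).

End OverSubalgebra.

(* Main.v *)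
(* Restricting a left A-linear retraction H -> A, which exists as A is injective
   over itself, flatness gives faithful flatness; so the point is to pass from
   left to right flatness.

   If H is left flat, then u : H -> Hom_k(A, H), u h = (x |-> h x), stays
   injective after tensoring with H over A, so the functional
   h (x)_A y |-> eps (h y) extends to a balanced form b on Hom_k(A, H) x H.
   Put theta(phi, y) = b(phi, S y_1) y_2. The antipode axioms give
   theta(phi(a_1 -), y a_2) = theta(phi, y) a and theta(u h_1, h_2) = h, i.e.
   H is a direct summand, as a right A-module, of Hom_k(A, H) (x) H with the
   diagonal action. Injectivity of A over itself provides elements
   sum_i C_ij (x) e_i commuting with A, by which Hom_k(A, k) is projective, and
   the inverse of S untwists the diagonal action; together they give a right
   A-linear section of the multiplication H (x) A -> H, hence right flatness.
   The converse is the same argument for the opposite algebras, with S and its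
   inverse exchanged. *)
Require Import Defs.
From HB Require Import structures.
From mathcomp Require Import all_boot all_algebra.
From mathcomp Require Import boolp classical_sets functions.

Set Implicit Arguments.
Unset Strict Implicit.
Unset Printing Implicit Defensive.

Import GRing.Theory.
Local Open Scope classical_set_scope.
Local Open Scope ring_scope.

(** * Linear maps over a field *)

Section LinearSelection.
Variables (k : fieldType) (V W : lmodType k).
Implicit Types (X Y G : set (V * W)).

Definition linear_relation X := X 0 /\ forall c p q, X p -> X q -> X (c *: p + q).

(** By Zorn's lemma there is a maximal single-valued linear relation between [G] and [R]. If it
    missed some [v], adjoining the line through [(v, w0)] with [R (v, w0)] would enlarge it.
    Choosing [R] and [G] suitably yields projections, quasi-inverses and extensions of functionals
    alike. *)
Lemma linear_selection (R G : set (V * W)) :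
  linear_relation R -> linear_relation G -> (G `<=` R) ->
  (forall w, G (0, w) -> w = 0) -> (forall v, exists w, R (v, w)) ->
  exists g : {linear V -> W},
    (forall v, R (v, g v)) /\ (forall v w, G (v, w) -> g v = w).
Proof.
move=> [R0 Rlin] Glin GR Gfun Rtot.
pose good X := [/\ linear_relation X, (X `<=` R) & forall w, X (0, w) -> w = 0].
have goodG : good G by [].
(* Goodness is asked of the union with [G], so that the empty chain is bounded as well. *)
have [|A [Agood Amax]] := @Zorn_bigcup _ [set X | good (X `|` G)].
  move=> F Fgood Ftot.
  have common p q : ((\bigcup_(X in F) X) `|` G) p ->
      ((\bigcup_(X in F) X) `|` G) q ->
      exists X, [/\ good X, (X `<=` (\bigcup_(X in F) X) `|` G), X p & X q].
    have sub X : F X -> (X `|` G `<=` (\bigcup_(X in F) X) `|` G).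
      by move=> FX x [Xx|Gx]; [left; exists X | right].
    move=> [[X FX Xp]|Gp] [[Y FY Yq]|Gq].
    - case: (Ftot _ _ FX FY) => XY.
        exists (Y `|` G); split; [exact: Fgood | exact: sub | left; exact: XY | by left].
      exists (X `|` G); split; [exact: Fgood | exact: sub | by left | left; exact: XY].
    - by exists (X `|` G); split; [exact: Fgood | exact: sub | left | right].
    - by exists (Y `|` G); split; [exact: Fgood | exact: sub | right | left].
    - by exists G; split=> // x; right.
  split=> [|p Xp|w Xw].
  - split=> [|c p q Xp Xq]; first by right; case: Glin.
    by have [X [[[_ Xlin] _ _] XF Xp' Xq']] := common p q Xp Xq; apply/XF/Xlin.
  - by have [X [[_ XR _] _ Xp' _]] := common p p Xp Xp; apply: XR.
  - by have [X [[_ _ Xfun] _ Xw' _]] := common _ _ Xw Xw; apply: Xfun.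
case: Agood; set X := (A `|` G) => -[X0 Xlin] XR Xfun.
have XZ c p : X p -> X (c *: p) by move=> Xp; rewrite -[_ *: _]addr0; apply: Xlin.
have Xtot v : exists w, X (v, w).
  apply: contrapT => Xv; have [w0 Rw0] := Rtot v.
  (* [B] is single-valued: a pair [(0, w)] in it with nonzero coefficient [d] would put [v] in the
     domain of [X]. *)
  pose B := [set p : V * W | exists c x, X x /\ p = c *: (v, w0) + x].
  have XB : (X `<=` B) by move=> x Xx; exists 0, x; rewrite scale0r add0r.
  apply: (Amax B).
    split=> [x Ax|BA]; first by apply: XB; left.
    by apply: Xv; exists w0; left; apply: BA; exists 1, 0; rewrite scale1r addr0.
  change (good (B `|` G)); have -> : B `|` G = B.
    by apply/seteqP; split=> [x [//|Gx]|x Bx]; [apply: XB; right | left].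
  split.
  - split=> [|c _ _ [d [x [Xx ->]]] [d' [x' [Xx' ->]]]]; first exact: XB.
    exists (c * d + d'), (c *: x + x'); split; first exact: Xlin.
    by rewrite scalerDr scalerA scalerDl addrACA.
  - by move=> _ [d [x [Xx ->]]]; apply: Rlin => //; exact: XR.
  - move=> w [d [x [Xx [e1 e2]]]]; have [d0|d0] := eqVneq d 0.
      move: e1 e2; rewrite d0 !scale0r !add0r => e1 ->.
      by apply: Xfun; rewrite e1 -surjective_pairing.
    case: Xv; exists (- d^-1 *: x).2; suff -> : v = (- d^-1 *: x).1.
      by rewrite -surjective_pairing; apply: XZ.
    rewrite /= scaleNr; apply: (scalerI d0).
    rewrite scalerN scalerA divff // scale1r; apply/eqP.
    by rewrite -addr_eq0; apply/eqP/esym.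
have [g Xg] := choice Xtot.
have XU v w w' : X (v, w) -> X (v, w') -> w = w'.
  move=> Xw Xw'; apply/eqP; rewrite -subr_eq0; apply/eqP/Xfun.
  have <- : -1 *: (v, w') + (v, w) = (0, w - w').
    by rewrite scaleN1r; congr (_, _); rewrite /= ?addNr // addrC.
  exact: Xlin.
have glin : linear g by move=> c v v'; apply: XU (Xg _) (Xlin c _ _ (Xg v) (Xg v')).
pose gL := GRing.isLinear.Build k V W *:%R g glin.
pose gl : {linear V -> W} := HB.pack g gL.
exists gl; split=> [v|v w Gvw]; first exact/XR/Xg.
by apply: XU (Xg v) _; right.
Qed.

End LinearSelection.

(** * Converse algebras, multilinear maps and quasi-inverses *)

HB.instance Definition _ (k : pzRingType) (V : lmodType k) := GRing.Lmodule.copy V^c V.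

Section ConverseAlgebra.
Variables (k : pzRingType) (A : algType k).
Fact converse_scalerAl c (x y : A^c) : c *: (x * y) = (c *: x : A^c) * y.
Proof. exact: (scalerAr c (y : A) (x : A)). Qed.
Fact converse_scalerAr c (x y : A^c) : c *: (x * y) = x * (c *: y : A^c).
Proof. exact: (scalerAl c (y : A) (x : A)). Qed.
HB.instance Definition _ := GRing.Lmodule_isLalgebra.Build k A^c converse_scalerAl.
HB.instance Definition _ := GRing.Lalgebra_isAlgebra.Build k A^c converse_scalerAr.
End ConverseAlgebra.

Definition trilinear_fun (k : comPzRingType) (L M N W : lmodType k)
    (f : L -> M -> N -> W) : Prop :=
  [/\ forall m n, linear (fun l => f l m n), forall l n, linear (fun m => f l m n)
    & forall l m, linear (f l m)].

Lemma linear_fun_sum (k : pzRingType) (V W : lmodType k) (I : Type) (r : seq I)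
    (f : I -> V -> W) :
  (forall i, linear (f i)) -> linear (fun x => \sum_(i <- r) f i x).
Proof.
move=> flin c x y; rewrite scaler_sumr -big_split /=.
by apply: eq_bigr => i _; rewrite flin.
Qed.

Lemma linear_fun_sumE (k : pzRingType) (V W : lmodType k) (f : V -> W)
    (I : Type) (r : seq I) (F : I -> V) :
  linear f -> f (\sum_(i <- r) F i) = \sum_(i <- r) f (F i).
Proof.
move=> flin; pose fB := GRing.isLinear.Build k V W *:%R f flin.
pose fL : {linear V -> W} := HB.pack f fB; exact: (linear_sum fL).
Qed.

Lemma linear_funZ (k : pzRingType) (V W : lmodType k) (f : V -> W) c x :
  linear f -> f (c *: x) = c *: f x.
Proof.
move=> flin; pose fB := GRing.isLinear.Build k V W *:%R f flin.
pose fL : {linear V -> W} := HB.pack f fB; exact: (linearZZ fL).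
Qed.

Lemma tens_liftD (k : comPzRingType) (M N W : lmodType k) (f : M -> N -> W) :
  bilinear_fun f -> {morph tens_lift f : x y / x + y}.
Proof. by move=> fbil; exact: (btens_liftD (bilinear_balanced fbil)). Qed.

(** A first selection extends the identity of the kernel of [g] to a projection [p] onto that
    kernel; a second one extends [g y |-> y - p y] from the image of [g] to all of [W]. *)
Lemma linear_quasi_inverse (k : fieldType) (V W : lmodType k) (g : {linear V -> W}) :
  exists t : {linear W -> V}, forall x, g (x - t (g x)) = 0.
Proof.
have [||||x|p [p0 pid]] := @linear_selection k V V [set x | g x.2 = 0]
    [set x | x.1 = x.2 /\ g x.2 = 0].
- by split=> [|c x y /= gx gy]; [exact: linear0 | rewrite linearP gx gy scaler0 addr0].
- split=> [|c x y /= [xx gx] [yy gy]]; first by split=> //; exact: linear0.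
  by split; [rewrite xx yy | rewrite linearP gx gy scaler0 addr0].
- by move=> x [].
- by move=> w [].
- by exists 0; exact: linear0.
have [||//|w|w|t [_ tE]] := @linear_selection k W V setT
    [set x | exists y, x = (g y, y - p y)].
- by split.
- split=> [|c _ _ [x ->] [y ->]]; first by exists 0; rewrite !raddf0 addr0.
  exists (c *: x + y); rewrite (linearP g) (linearP p); congr (_, _).
  by rewrite /= scalerBr opprD addrACA.
- by move=> [y [gy0 ->]]; rewrite (pid y y) ?subrr //; split.
- by exists 0.
by exists t => x; rewrite (tE _ (x - p x)); [rewrite subKr p0 | exists x].
Qed.

(** A separate name for [N], which is to carry the structure over [k] besides the one over [A]:
    quasi-inverses are available over the field only. *)
Definition scalars (k : pzRingType) (A : algType k) (N : lmodType A) : Type := N.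

Section Scalars.
Variables (k : comPzRingType) (A : algType k) (N : lmodType A).
Local Notation N' := (scalars N).
HB.instance Definition _ := GRing.Zmodule.on N'.
Definition scalars_scale (c : k) (n : N') : N' := (c%:A : A) *: (n : N).
Fact scalars_scaleA c c' n : scalars_scale c (scalars_scale c' n) = scalars_scale (c * c') n.
Proof. by rewrite /scalars_scale scalerA -scalerAl mul1r scalerA. Qed.
Fact scalars_scale1 : left_id 1 scalars_scale.
Proof. by move=> n; rewrite /scalars_scale !scale1r. Qed.
Fact scalars_scaleDr : right_distributive scalars_scale +%R.
Proof. by move=> c n n'; exact: scalerDr. Qed.
Fact scalars_scaleDl n : {morph scalars_scale^~ n : c c' / c + c'}.
Proof. by move=> c c'; rewrite /scalars_scale !scalerDl. Qed.
HB.instance Definition _ := GRing.Zmodule_isLmodule.Build k N'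
  scalars_scaleA scalars_scale1 scalars_scaleDr scalars_scaleDl.
End Scalars.

Lemma tens_mulr_bilinear (k : comPzRingType) (M : lmodType k) (A : algType k) (a : A) :
  bilinear_fun (fun (x : M) (z : A) => tens_pure x (z * a)).
Proof.
split=> [x c z z'|z c x x'].
  by rewrite mulrDl -scalerAl tens_pureDr tens_pureZr.
by rewrite tens_pureDl tens_pureZl.
Qed.

Lemma mul_linear_bilinear (k : fieldType) (H A : algType k) (v : {linear A -> H}) :
  bilinear_fun (fun (x : H) (z : A) => x * v z).
Proof.
split=> [x c z z'|z c x x']; first by rewrite linearP mulrDr -scalerAr.
by rewrite mulrDl -scalerAl.
Qed.

(** * Flatness from a linear section of the multiplication *)

Section ProjectiveFlat.
Variables (k : fieldType) (H A : algType k) (v : {linear A -> H}).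
Variable s : H -> tens H A.
Hypotheses (v1 : v 1 = 1) (slin : linear s)
  (sM : forall h a, s (h * v a) = tens_lift (fun x z => tens_pure x (z * a)) (s h))
  (sK : forall h, tens_lift (fun x z => x * v z) (s h) = h).

Local Notation T N := (btens (fun (h : H) (a : A) => h * v a) (fun (a : A) (n : N) => a *: n)).

(** The section [s] makes [H] a direct summand of the free right module [H (x) A], hence projective.
    Concretely, if [t] is a [k]-linear quasi-inverse of [g] and [s h] is the sum of the [x (x) z],
    then sending [h (x) n] to the sum of the [x (x) t (z n)] defines a map [B] back from the third
    term, and every [w] differs from [B (g w)] by an element of the image of [f]. *)
Lemma section_exact (N1 N2 N3 : lmodType A) (f : {linear N1 -> N2}) (g : {linear N2 -> N3}) :
  exact_at f g ->
  exact_at (btens_map idfun f : T N1 -> T N2) (btens_map idfun g : T N2 -> T N3).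
Proof.
move=> fg.
have map_bal (N N' : lmodType A) (l : {linear N -> N'}) :
    balanced (fun (h : H) (a : A) => h * v a) (fun (a : A) (n : N) => a *: n)
      (fun h n => btens_pure _ _ h (l n) : T N').
  split=> [h h' n|h n n'|h a n]; first exact: btens_pureDl.
    by rewrite linearD btens_pureDr.
  by rewrite btens_pure_act linearZ.
have mapE (N N' : lmodType A) (l : {linear N -> N'}) h n :
    btens_map idfun l (btens_pure _ _ h n : T N) = btens_pure _ _ h (l n) :> T N'.
  exact: (btens_liftE (map_bal N N' l)).
have mapD (N N' : lmodType A) (l : {linear N -> N'}) (t t' : T N) :
    btens_map idfun l (t + t') = btens_map idfun l t + btens_map idfun l t' :> T N'.
  exact: (btens_liftD (map_bal N N' l)).
pose gS := GRing.isLinear.Build k (scalars N2) (scalars N3) *:%R g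
  (fun c => linearP g (c%:A : A)).
pose gk : {linear scalars N2 -> scalars N3} := HB.pack (g : scalars N2 -> scalars N3) gS.
have [t tg] := linear_quasi_inverse gk.
have tZ c n : t (c%:A *: (n : N3) : N3) = c%:A *: (t n : N2) by exact: (linearZZ t c n).
have tD (n n' : N3) : t (n + n' : N3) = (t n : N2) + t n' by exact: (linearD t n n').
have ft (n : N2) : exists m, n - t (g n) = f m.
  by have /fg [m <-] := tg n; exists m.
(* As [t] is linear over [k] only, [F] is balanced over [k] and not over [A]; the free factor [A]
   absorbs the action instead. *)
pose F (n : N3) (x : H) (z : A) : T N2 := btens_pure _ _ x (t (z *: n) : N2).
have Fbal n : balanced (fun (x : H) (c : k) => c *: x) (fun (c : k) (z : A) => c *: z) (F n).
  split=> [x x' z|x z z'|x c z]; rewrite /F; first exact: btens_pureDl.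
    by rewrite scalerDl tD btens_pureDr.
  have -> : c *: z = c%:A * z by rewrite -scalerAl mul1r.
  rewrite -scalerA tZ -btens_pure_act; congr (btens_pure _ _ _ _).
  by rewrite linearZ v1 /= -scalerAr mulr1.
pose L n (w : tens H A) : T N2 := tens_lift (F n) w.
have LE n x z : L n (tens_pure x z) = F n x z by exact: (btens_liftE (Fbal n)).
have LD n w w' : L n (w + w') = L n w + L n w' by exact: (btens_liftD (Fbal n)).
have Ra_bil := @tens_mulr_bilinear k H A.
pose B (h : H) (n : N3) := L n (s h).
have Bbal : balanced (fun (h : H) (a : A) => h * v a) (fun (a : A) (n : N3) => a *: n) B.
  split=> [h h' n|h n n'|h a n]; rewrite /B.
  - by rewrite -[h]scale1r slin scale1r LD scale1r.
  - elim/tens_ind: (s h) => [x z|w w' IH IH']; last by rewrite !LD IH IH' addrACA.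
    by rewrite !LE /F scalerDr tD btens_pureDr.
  - rewrite sM; elim/tens_ind: (s h) => [x z|w w' IH IH'].
      by rewrite (tens_liftE (Ra_bil a)) !LE /F scalerA.
    by rewrite (tens_liftD (Ra_bil a)) !LD IH IH'.
have Mbil := mul_linear_bilinear v.
have decomp (w : T N2) : exists u : T N1,
    w = btens_map idfun f u + btens_lift B (btens_map idfun g w : T N3).
  elim/btens_ind: w => [h n|w w' [u uE] [u' uE']]; last first.
    by exists (u + u'); rewrite !mapD (btens_liftD Bbal) addrACA -uE -uE'.
  rewrite mapE (btens_liftE Bbal) /B.
  (* Replacing [s h] by an arbitrary tensor permits induction; [sK] then gives back [h]. *)
  suff /(_ (s h)) : forall w, exists u : T N1,
      btens_pure _ _ (tens_lift (fun x z => x * v z) w) n = btens_map idfun f u + L (g n) w.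
    by rewrite sK.
  elim/tens_ind => [x z|w w' [u uE] [u' uE']].
    have [m mE] := ft (z *: n); exists (btens_pure _ _ x m).
    rewrite mapE -mE LE (tens_liftE Mbil) /F btens_pure_act -btens_pureDr.
    by rewrite -linearZ subrK.
  exists (u + u'); rewrite (tens_liftD Mbil) btens_pureDl.
  by rewrite uE uE' mapD LD addrACA.
move=> w; split=> [gw0|[u <-]].
  have [u ->] := decomp w; exists u; rewrite gw0.
  suff -> : btens_lift B (0 : T N3) = 0 by rewrite addr0.
  by apply: (addIr (btens_lift B (0 : T N3))); rewrite -(btens_liftD Bbal) !add0r.
elim/btens_ind: u => [h m|u u' IH IH']; last by rewrite !mapD IH IH' addr0.
rewrite !mapE; have -> : g (f m) = 0 by apply/fg; exists m.
by apply: (addIr (btens_pure _ _ h 0)); rewrite -btens_pureDr !add0r.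
Qed.
End ProjectiveFlat.

(** * Finite bases, spaces of linear maps and Casimir elements *)

Record coordinates (k : fieldType) (V : lmodType k) := Coordinates {
  coord_dim : nat;
  coord_vec : 'I_coord_dim -> V;
  coord_fun : 'I_coord_dim -> {linear V -> k^o};
  coord_sum : forall x, \sum_i coord_fun i x *: coord_vec i = x;
  coord_delta : forall i j, coord_fun i (coord_vec j) = (j == i)%:R }.
Arguments coord_vec {k V} c i.
Arguments coord_fun {k V} c i.
Arguments coord_sum {k V} c x.
Arguments coord_delta {k V} c i j.

Lemma finite_dimensional_coordinates (k : fieldType) (V : lmodType k) :
  finite_dimensional V -> inhabited (coordinates V).
Proof.
move=> [n [[v2r v2rlin [r2v v2rK r2vK]]]].
have v2rZ c x : v2r (c *: x) = c *: v2r x by exact: linear_funZ.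
have v2rs I (r : seq I) (F : I -> V) : v2r (\sum_(i <- r) F i) = \sum_(i <- r) v2r (F i).
  exact: linear_fun_sumE.
have clin i : linear ((fun x => v2r x 0 i) : V -> k^o).
  by move=> c x y; rewrite v2rlin !mxE.
pose cL i := GRing.isLinear.Build k V k^o *:%R (fun x => v2r x 0 i) (clin i).
pose cf i : {linear V -> k^o} := HB.pack ((fun x => v2r x 0 i) : V -> k^o) (cL i).
constructor; apply: (@Coordinates _ _ n (fun i => r2v (delta_mx 0 i)) cf) => [x|i j].
  apply: (can_inj v2rK); rewrite v2rs [RHS]row_sum_delta; apply: eq_bigr => i _.
  by rewrite v2rZ r2vK.
by rewrite /= r2vK mxE eqxx eq_sym.
Qed.

(* The maps from A to W that are linear over k, given by their values on a basis,
   with the action [(a phi) x = phi (x * a)]. *)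
Definition coinduced (k : fieldType) (A : algType k) (B : coordinates A)
  (W : lmodType k) : Type := 'I_(coord_dim B) -> W.

Section Coinduced.
Variables (k : fieldType) (A : algType k) (B : coordinates A) (W : lmodType k).
Local Notation N := (coinduced B W).
Local Notation e := (coord_vec B).
Local Notation ec := (coord_fun B).
HB.instance Definition _ := GRing.Zmodule.copy N ('I_(coord_dim B) -> W).

Let addE (phi psi : N) n : (phi + psi) n = phi n + psi n. Proof. by []. Qed.

Definition coinduced_scale (a : A) (phi : N) : N :=
  fun n => \sum_m ec m (e n * a) *: phi m.
Fact coinduced_scaleA a a' phi :
  coinduced_scale a (coinduced_scale a' phi) = coinduced_scale (a * a') phi.
Proof.
apply/funext => n; rewrite /coinduced_scale.
under eq_bigr do rewrite scaler_sumr; rewrite exchange_big /=; apply: eq_bigr => l _.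
rewrite mulrA -[in RHS](coord_sum B (e n * a)) mulr_suml linear_sum scaler_suml.
by apply: eq_bigr => m _; rewrite -scalerAl (linearZZ (ec l)) -scalerA.
Qed.
Fact coinduced_scale1 : left_id 1 coinduced_scale.
Proof.
move=> phi; apply/funext => n; rewrite /coinduced_scale (bigD1 n) //= big1 ?addr0.
  by rewrite mulr1 coord_delta eqxx scale1r.
by move=> m mn; rewrite mulr1 coord_delta eq_sym (negPf mn) scale0r.
Qed.
Fact coinduced_scaleDr : right_distributive coinduced_scale +%R.
Proof.
move=> a phi psi; apply/funext => n; rewrite addE -big_split /=.
by apply: eq_bigr => m _; rewrite scalerDr.
Qed.
Fact coinduced_scaleDl phi : {morph coinduced_scale^~ phi : a a' / a + a'}.
Proof.
move=> a a'; apply/funext => n; rewrite addE -big_split /=.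
by apply: eq_bigr => m _; rewrite mulrDr linearD scalerDl.
Qed.
HB.instance Definition _ := GRing.Zmodule_isLmodule.Build A N
  coinduced_scaleA coinduced_scale1 coinduced_scaleDr coinduced_scaleDl.

(** Expanding [e n * a] in the basis turns the matrix formula of the action into translation of the
    argument. *)
Lemma coinduced_scaleE (phi : A -> W) a :
  linear phi -> a *: (phi \o e : N) = (fun n => phi (e n * a)) :> N.
Proof.
move=> phil; apply/funext => n; rewrite -[in RHS](coord_sum B (e n * a)).
by rewrite (linear_fun_sumE _ _ phil); apply: eq_bigr => m _; rewrite (linear_funZ _ _ phil).
Qed.

Lemma coinduced_scalar c (g : N) : (c%:A : A) *: g = (fun n => c *: g n) :> N.
Proof.
apply/funext => n; rewrite -[in RHS](scale1r g) -[LHS]/(coinduced_scale _ _ _).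
rewrite -[(1 *: g) n]/(coinduced_scale _ _ _) /coinduced_scale scaler_sumr.
by apply: eq_bigr => m _; rewrite -scalerAr mulr1 (linearZZ (ec m)) scalerA.
Qed.

End Coinduced.

(* A retraction [rho] of [x |-> (y |-> y * x)] : A -> End_k(A) gives the [C i j], as the
   images of the matrix units [x |-> (ec i x) e_j]. *)
Lemma casimir_family (k : fieldType) (A : algType k) (B : coordinates A) :
  injective_module (A^o : lmodType A) ->
  exists C : 'I_(coord_dim B) -> 'I_(coord_dim B) -> A,
    (forall (W : lmodType k) (f : A -> A -> W) j a, bilinear_fun f ->
      \sum_i f (a * C i j) (coord_vec B i) = \sum_i f (C i j) (coord_vec B i * a)) /\
    \sum_i C i i = 1.
Proof.
pose e := coord_vec B; pose ec := coord_fun B.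
move=> Ainj; pose i (a : A^o) : coinduced B A := (fun x => x * a) \o e.
have ilin : linear i.
  move=> a x y; rewrite coinduced_scaleE; last by move=> c z z'; rewrite mulrDl scalerAl.
  by apply/funext => n; rewrite /i /= mulrDr mulrA.
pose iB := GRing.isLinear.Build A A^o (coinduced B A) *:%R i ilin.
pose iL : {linear A^o -> coinduced B A} := HB.pack i iB.
have iinj : injective iL.
  move=> x y xy; have xyn n : e n * (x : A) = e n * (y : A) := congr1 (fun phi => phi n) xy.
  (* Since 1 is a combination of the [e n], the products [e n * x] determine [x]. *)
  rewrite -[LHS](mul1r (x : A)) -[RHS](mul1r (y : A)) -(coord_sum B 1) !mulr_suml.
  by apply: eq_bigr => n _; rewrite -!scalerAl xyn.
pose idL := [the {linear A^o -> A^o} of idfun].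
have [rho rhoK] := Ainj _ _ iL idL iinj.
have rhoM (phi : A -> A) a : linear phi ->
    rho (fun n => phi (e n * a)) = a * (rho (phi \o e) : A).
  by move=> phil; rewrite -coinduced_scaleE // linearZ.
have rhoZ (phi : A -> A) c : linear phi ->
    rho (fun n => c *: phi (e n)) = c *: (rho (phi \o e) : A) :> A.
  move=> phil; have -> : c *: (rho (phi \o e) : A) = c%:A * (rho (phi \o e) : A).
    by rewrite -scalerAl mul1r.
  rewrite -rhoM //; congr (rho _ : A).
  by apply/funext => n; rewrite -scalerAr mulr1 linear_funZ.
pose phi m j (x : A) : A := ec m x *: e j.
have phil m j : linear (phi m j) by move=> c x y; rewrite /phi linearP scalerDl scalerA.
exists (fun m j => rho (phi m j \o e)); split=> [W f j a [fr fl]|]; last first.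
  (* The diagonal matrix units add up to the identity map, which is [iL 1]. *)
  transitivity (rho (iL 1) : A); last exact: rhoK.
  rewrite -(linear_sum rho); congr (rho _ : A); apply/funext => n.
  by rewrite fct_sumE; apply: etrans (coord_sum B _) (esym (mulr1 (e n : A))).
(* The coefficients [ec l (e m * a)] are also those of [e m * a] in the basis, so the two sides of
   the Casimir identity expand into the same double sum. *)
have CM l : a * (rho (phi l j \o e) : A) =
    \sum_m ec l (e m * a) *: (rho (phi m j \o e) : A).
  under eq_bigr do rewrite -rhoZ //.
  rewrite -rhoM // -(linear_sum rho); congr (rho _ : A); apply/funext => n.
  rewrite fct_sumE /phi -[in LHS](coord_sum B (e n)) mulr_suml linear_sum scaler_suml.
  by apply: eq_bigr => m _; rewrite -scalerAl (linearZZ (ec l)) scalerA mulrC.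
under eq_bigr do rewrite CM (linear_fun_sumE _ _ (fl _)).
rewrite exchange_big /=; apply: eq_bigr => m _.
rewrite -[in RHS](coord_sum B (e m * a)) (linear_fun_sumE _ _ (fr _)).
by apply: eq_bigr => l _; rewrite (linear_funZ _ _ (fl _)) (linear_funZ _ _ (fr _)).
Qed.
(** * The section of the multiplication *)

(* The comultiplication h |-> h_1 (x) h_2 is given by lists [D h] of pairs, and
   [S'] plays the role of the inverse of [S]. The hypotheses are stated so as to
   hold both for a Hopf algebra and for its opposite algebra. *)
Section ProjectiveSection.
Variables (k : fieldType) (H A : algType k) (v : {linear A -> H}).
Hypotheses (vM : forall a a', v (a * a') = v a * v a').
Variables (pi : {linear H -> A}).
Hypothesis piv : forall a, pi (v a) = a.

Variables (D : H -> seq (H * H)) (eps : {linear H -> k^o}) (S S' : {linear H -> H}).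
Hypotheses
  (Dlin : forall (W : lmodType k) (f : H -> H -> W), bilinear_fun f ->
     linear (fun h => \sum_(p <- D h) f p.1 p.2))
  (DM : forall (W : lmodType k) (f : H -> H -> W) x y, bilinear_fun f ->
     \sum_(p <- D (x * y)) f p.1 p.2 =
     \sum_(p <- D x) \sum_(q <- D y) f (p.1 * q.1) (p.2 * q.2))
  (DDA : forall (W : lmodType k) (f : H -> H -> H -> W) h, trilinear_fun f ->
     \sum_(p <- D h) \sum_(q <- D p.1) f q.1 q.2 p.2 =
     \sum_(p <- D h) \sum_(q <- D p.2) f p.1 q.1 q.2)
  (epsl : forall h, \sum_(p <- D h) eps p.1 *: p.2 = h)
  (epsr : forall h, \sum_(p <- D h) eps p.2 *: p.1 = h)
  (eps1 : eps 1 = 1)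
  (SM : forall x y, S (x * y) = S y * S x)
  (S'M : forall x y, S' (x * y) = S' y * S' x)
  (Sr : forall h, \sum_(p <- D h) p.1 * S p.2 = (eps h)%:A)
  (S'l : forall h, \sum_(p <- D h) S' p.2 * p.1 = (eps h)%:A)
  (S'r : forall h, \sum_(p <- D h) p.2 * S' p.1 = (eps h)%:A)
  (Dv : forall (W : lmodType k) (f : H -> H -> W) a, bilinear_fun f ->
     \sum_(p <- D (v a)) f (v (pi p.1)) p.2 = \sum_(p <- D (v a)) f p.1 p.2).

Variable b : (A -> H) -> H -> k^o.
Hypotheses (bbil : bilinear_fun b)
  (bA : forall phi a y, linear phi -> b (fun x => phi (a * x)) y = b phi (v a * y))
  (bv : forall h y, b (fun x => h * v x) y = eps (h * y)).

Let bPr phi : linear (b phi). Proof. exact: bbil.1. Qed.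
Let bPl y : linear (b^~ y). Proof. exact: bbil.2. Qed.
Let bPl' phi psi c y : b (c *: phi + psi) y = c *: b phi y + b psi y.
Proof. exact: bPl. Qed.

Definition theta (phi : A -> H) (y : H) : H :=
  \sum_(p <- D y) b phi (S p.1) *: p.2.

Lemma theta_linearl y : linear (theta^~ y).
Proof.
rewrite /theta; apply: linear_fun_sum => p c phi psi.
by rewrite bPl' scalerDl scalerA.
Qed.

Lemma theta_linearr phi : linear (theta phi).
Proof.
apply: (Dlin (f := fun x y => b phi (S x) *: y)); split=> [x c y z|y c x z].
  by rewrite scalerDr !scalerA mulrC.
by rewrite linearP bPr scalerDl scalerA.
Qed.

(** By [bv] and coassociativity the sum is [eps(h_1 S(h_2)) h_3], which the antipode and counit
    axioms reduce to [h]. *)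
Lemma theta_unit h : \sum_(p <- D h) theta (fun x => p.1 * v x) p.2 = h.
Proof.
rewrite /theta; under eq_bigr do under eq_bigr do rewrite bv.
rewrite -(DDA (f := fun x y z => eps (x * S y) *: z)); last first.
  split=> [y z c x x'|x z c y y'|x y c z z'].
  - by rewrite mulrDl -scalerAl linearP scalerDl scalerA.
  - by rewrite linearP mulrDr -scalerAr linearP scalerDl scalerA.
  - by rewrite scalerDr !scalerA mulrC.
under eq_bigr do rewrite -scaler_suml -linear_sum Sr linearZ /= eps1 -[_ *: 1]mulr1 -scalerAl.
under eq_bigr do rewrite mulr1 -[_ *: 1]/(_ * 1) mulr1.
exact: epsl.
Qed.

(* [theta] is right A-linear for the diagonal action [phi(a_1 -) (x) y a_2]. *)
Lemma theta_act phi y a : linear phi ->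
  \sum_(p <- D (v a)) theta (fun x => phi (pi p.1 * x)) (y * p.2) = theta phi y * v a.
Proof.
move=> phil; rewrite /theta mulr_suml.
have thM p : \sum_(z <- D (y * p.2)) b (fun x => phi (pi p.1 * x)) (S z.1) *: z.2 =
    \sum_(q <- D y) \sum_(r <- D p.2) b phi (v (pi p.1) * S (q.1 * r.1)) *: (q.2 * r.2).
  rewrite (DM (f := fun z z' => b (fun x => phi (pi p.1 * x)) (S z) *: z')).
    by apply: eq_bigr => q _; apply: eq_bigr => r _; rewrite (bA _ _ phil).
  split=> [x c z z'|x c z z']; first by rewrite scalerDr !scalerA mulrC.
  by rewrite linearP bPr scalerDl scalerA.
under eq_bigr do rewrite thM.
rewrite exchange_big /=; apply: eq_bigr => q _.
(* The coideal condition removes [v (pi -)]. Coassociativity then brings together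
   [a_1 S(y_1 a_2) = a_1 S(a_2) S(y_1)], where [Sr] contracts the first two factors. *)
rewrite (Dv (f := fun x z => \sum_(r <- D z) b phi (x * S (q.1 * r.1)) *: (q.2 * r.2))).
  rewrite -(DDA (f := fun x r1 r2 => b phi (x * S (q.1 * r1)) *: (q.2 * r2))).
    rewrite -[in RHS](epsl (v a)) mulr_sumr; apply: eq_bigr => p _.
    under eq_bigr do rewrite SM mulrA.
    rewrite -scaler_suml -(linear_fun_sumE _ _ (bPr phi)) -mulr_suml Sr -scalerAl mul1r.
    by rewrite linear_funZ // -scalerAr -scalerAl !scalerA.
  split=> [r1 r2 c x x'|x r2 c z z'|x z c r r'].
  - by rewrite mulrDl -scalerAl bPr scalerDl scalerA.
  - by rewrite mulrDr -scalerAr linearP mulrDr -scalerAr bPr scalerDl scalerA.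
  - by rewrite mulrDr -scalerAr scalerDr !scalerA mulrC.
split=> [x|z].
  apply: (Dlin (f := fun r1 r2 => b phi (x * S (q.1 * r1)) *: (q.2 * r2))).
  split=> [r1 c r r'|r2 c r r'].
  - by rewrite mulrDr -scalerAr scalerDr !scalerA mulrC.
  - by rewrite mulrDr -scalerAr linearP mulrDr -scalerAr bPr scalerDl scalerA.
apply: linear_fun_sum => r c x x'.
by rewrite mulrDl -scalerAl bPr scalerDl scalerA.
Qed.

(* [psi (x) y S'(a_2)] acted on by [a_1] is [psi(a -) (x) y]. *)
Lemma theta_untwist (psi : {linear A -> H}) y a :
  \sum_(q <- D (v a)) theta psi (y * S' q.2) * v (pi q.1) =
  theta (fun x => psi (a * x)) y.
Proof.
have psil : linear psi by exact: linearP.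
under eq_bigr do rewrite -(theta_act _ _ psil).
have thl x1 x2 c z : theta (fun x => psi (pi (c *: x1 + x2) * x)) z =
    c *: theta (fun x => psi (pi x1 * x)) z + theta (fun x => psi (pi x2 * x)) z.
  rewrite -theta_linearl; congr theta; apply/funext => x.
  by rewrite linearP mulrDl -scalerAl linearP.
have thr phi w c x x' z : theta phi (w * (c *: x + x') * z) =
    c *: theta phi (w * x * z) + theta phi (w * x' * z).
  by rewrite mulrDr mulrDl -scalerAr -scalerAl theta_linearr.
(* After [theta_act], dropping [v (pi -)] and using coassociativity leave [psi(a_1 -)] paired with
   [y S'(a_3) a_2]; here [S'l] contracts [S'(a_3) a_2]. *)
rewrite (Dv (f := fun x z => \sum_(r <- D x)
   theta (fun x0 => psi (pi r.1 * x0)) (y * S' z * r.2))); last first.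
  split=> [x|z].
    by apply: linear_fun_sum => r c x' z; rewrite linearP thr.
  apply: (Dlin (f := fun r1 r2 => theta (fun x0 => psi (pi r1 * x0)) (y * S' z * r2))).
  split=> [r1 c r r'|r2 c r r']; last exact: thl.
  by rewrite mulrDr -scalerAr theta_linearr.
rewrite (DDA (f := fun r1 r2 q2 =>
  theta (fun x0 => psi (pi r1 * x0)) (y * S' q2 * r2))); last first.
  split=> [m n c x x'|l n c x x'|l m c x x']; first exact: thl.
    by rewrite mulrDr -scalerAr theta_linearr.
  by rewrite linearP thr.
have thl' z : linear (fun x1 => theta (fun x => psi (pi x1 * x)) z).
  by move=> c x1 x2; exact: thl.
rewrite -[in RHS](piv a) -[in RHS](epsr (v a)) (linear_fun_sumE _ _ (thl' y)).
apply: eq_bigr => p _; under eq_bigr do rewrite -mulrA.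
rewrite -(linear_fun_sumE _ _ (theta_linearr _)).
rewrite -mulr_sumr S'l -scalerAr mulr1 linear_funZ; last exact: theta_linearr.
by rewrite (linear_funZ _ _ (thl' y)).
Qed.

Variables (B : coordinates A) (C : 'I_(coord_dim B) -> 'I_(coord_dim B) -> A).
Local Notation e := (coord_vec B).
Local Notation ec := (coord_fun B).
Hypotheses (CA : forall (W : lmodType k) (f : A -> A -> W) j a, bilinear_fun f ->
     \sum_i f (a * C i j) (e i) = \sum_i f (C i j) (e i * a))
  (C1 : \sum_i C i i = 1).

Let psi j (h : H) (x : A) : H := ec j x *: h.

Let psi_linearr j h : linear (psi j h).
Proof. by move=> c x y; rewrite /psi linearP scalerDl scalerA. Qed.

Let psi_linearl j : linear (psi j).
Proof.
by move=> c x y; apply/funext => z; rewrite /psi scalerDr !scalerA mulrC -scalerA.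
Qed.

Let theta_psi_linear j y : linear (fun h => theta (psi j h) y).
Proof. by move=> c x x'; rewrite psi_linearl theta_linearl. Qed.

(** The Casimir elements write [x |-> h_1 x] as the sum of the maps [psi j (h_1 C_ij)] acted on by
    [e_i]. The factor [S' q.2] turns this action on the first component into the diagonal one, so
    that [theta] carries it to right multiplication by [q.1], the part of [e_i] kept in the factor
    [A]. *)
Definition proj_section (h : H) : tens H A :=
  \sum_j \sum_i \sum_(p <- D h) \sum_(q <- D (v (e i)))
    tens_pure (theta (psi j (p.1 * v (C i j))) (p.2 * S' q.2)) (pi q.1).

Let G j (x y : H) (z : H) : tens H A := tens_pure (theta (psi j x) y) (pi z).

Let G_trilinear j : trilinear_fun (G j).
Proof.
split=> [y z c x x'|x z c y y'|x y c z z']; rewrite /G.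
- by rewrite theta_psi_linear tens_pureDl tens_pureZl.
- by rewrite theta_linearr tens_pureDl tens_pureZl.
- by rewrite linearP tens_pureDr tens_pureZr.
Qed.

Let G1 j y z : linear (fun x => G j x y z). Proof. by case: (G_trilinear j). Qed.
Let G2 j x z : linear (fun y => G j x y z). Proof. by case: (G_trilinear j). Qed.
Let G3 j x y : linear (G j x y). Proof. by case: (G_trilinear j). Qed.

Lemma proj_section_linear : linear proj_section.
Proof.
apply: linear_fun_sum => j; apply: linear_fun_sum => i.
apply: (Dlin (f := fun x y => \sum_(q <- D (v (e i))) G j (x * v (C i j)) (y * S' q.2) q.1)).
split=> [x|y]; apply: linear_fun_sum => q c z z'.
  by rewrite mulrDl -scalerAl G2.
by rewrite mulrDl -scalerAl G1.
Qed.

(** Expanding the coproduct of [h a] puts [a_1] in front of [C_ij] and [a_2] in front of [S']. The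
    Casimir identity moves [a_1] over to [e_i], and the coproduct of [e_i a_1] yields the factor [a]
    on the right, the rest cancelling against [S']. *)
Lemma proj_sectionM h a :
  proj_section (h * v a) = tens_lift (fun x z => tens_pure x (z * a)) (proj_section h).
Proof.
have Ra_bil := @tens_mulr_bilinear k H A a.
have Rasum := linear_fun_sumE _ _ (tens_lift_linear Ra_bil).
rewrite /proj_section Rasum; apply: eq_bigr => j _; rewrite Rasum.
transitivity (\sum_(p <- D h) \sum_(r <- D (v a)) \sum_i \sum_(q <- D (v (e i)))
    G j (p.1 * v (pi r.1 * C i j)) (p.2 * r.2 * S' q.2) q.1).
  transitivity (\sum_i \sum_(p <- D h) \sum_(r <- D (v a)) \sum_(q <- D (v (e i)))
      G j (p.1 * v (pi r.1) * v (C i j)) (p.2 * r.2 * S' q.2) q.1).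
    apply: eq_bigr => i _.
    rewrite (DM (f := fun x y => \sum_(q <- D (v (e i))) G j (x * v (C i j)) (y * S' q.2) q.1)).
      apply: eq_bigr => p _.
      rewrite (Dv (f := fun x y => \sum_(q <- D (v (e i)))
        G j (p.1 * x * v (C i j)) (p.2 * y * S' q.2) q.1)) //.
      split=> [x|y]; apply: linear_fun_sum => q c z z'.
        by rewrite mulrDr -scalerAr mulrDl -scalerAl G2.
      by rewrite mulrDr -scalerAr mulrDl -scalerAl G1.
    split=> [x|y]; apply: linear_fun_sum => q c z z'.
      by rewrite mulrDl -scalerAl G2.
    by rewrite mulrDl -scalerAl G1.
  rewrite exchange_big /=; apply: eq_bigr => p _.
  rewrite exchange_big /=; apply: eq_bigr => r _.
  by apply: eq_bigr => i _; apply: eq_bigr => q _; rewrite vM mulrA.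
under [RHS]eq_bigr do rewrite Rasum.
rewrite [RHS]exchange_big /=; apply: eq_bigr => p _.
(* Here [pi r.1], an element of [A], passes from the left of [C i j] to the right of [e i]. *)
under eq_bigr => r _.
  rewrite (CA (f := fun c z => \sum_(q <- D (v z))
    G j (p.1 * v c) (p.2 * r.2 * S' q.2) q.1)); last first.
    split=> [c|z].
      have Glin : linear (fun z => \sum_(q <- D z) G j (p.1 * v c) (p.2 * r.2 * S' q.2) q.1).
        apply: (Dlin (f := fun x y => G j (p.1 * v c) (p.2 * r.2 * S' y) x)).
        split=> [x c' y y'|y]; last exact: G3.
        by rewrite linearP mulrDr -scalerAr G2.
      by move=> c' z z'; rewrite linearP Glin.
    by apply: linear_fun_sum => q c x x'; rewrite linearP mulrDr -scalerAr G1.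
  over.
rewrite exchange_big /=; apply: eq_bigr => i _; rewrite Rasum.
under eq_bigr do rewrite vM.
pose F x y z := G j (p.1 * v (C i j)) (p.2 * y * S' z) x.
have F1 y z : linear (fun x => F x y z) by exact: G3.
have F2 x z : linear (fun y => F x y z).
  by move=> c y y'; rewrite /F mulrDr -scalerAr mulrDl -scalerAl G2.
have F3 x y : linear (F x y).
  by move=> c z z'; rewrite /F linearP mulrDr -scalerAr G2.
have Fb y : bilinear_fun (fun x z => F x y z) by split=> [x|z]; [exact: F3 | exact: F1].
(* With [v (pi -)] removed from the first leg of [a], the coproduct of [e_i a_1] can be expanded and
   rebracketed with the second leg. *)
rewrite (Dv (f := fun x y => \sum_(q <- D (v (e i) * x)) F q.1 y q.2)); last first.
  split=> [x|y]; first by apply: linear_fun_sum.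
  by move=> c x x'; rewrite mulrDr -scalerAr (Dlin (Fb y)).
under eq_bigr do rewrite (DM (f := fun x z => F x _ z)) //.
transitivity (\sum_(q <- D (v (e i))) F (q.1 * v a) 1 q.2); last first.
  rewrite -(Dv (f := fun x z => F (x * v a) 1 z)).
    by apply: eq_bigr => q _; rewrite (tens_liftE Ra_bil) /F /G -vM piv mulr1.
  split=> [x|z]; first exact: F3.
  by move=> c x x'; rewrite mulrDl -scalerAl F1.
rewrite exchange_big /=; apply: eq_bigr => q _.
(* Now [a_3 S'(q.2 a_2) = a_3 S'(a_2) S'(q.2)], and [S'r] contracts [a_3 S'(a_2)], leaving [a_1] as
   the factor next to [q.1]. *)
rewrite (DDA (f := fun t1 t2 r2 => F (q.1 * t1) r2 (q.2 * t2))); last first.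
  split=> [t r c x x'|t r c x x'|t r c x x'] /=.
  - by rewrite mulrDr -scalerAr F1.
  - by rewrite mulrDr -scalerAr F3.
  - by rewrite F2.
transitivity (\sum_(r <- D (v a)) F (q.1 * (eps r.2 *: r.1)) 1 q.2).
  apply: eq_bigr => r _.
  transitivity (\sum_(t <- D r.2) F (q.1 * r.1) (t.2 * S' t.1) q.2).
    by apply: eq_bigr => t _; rewrite /F S'M !mulrA.
  rewrite -(linear_fun_sumE _ _ (F2 _ _)) S'r.
  by rewrite (linear_funZ _ _ (F2 _ _)) -scalerAr (linear_funZ _ _ (F1 _ _)).
by rewrite -(linear_fun_sumE _ _ (F1 _ _)) -mulr_sumr epsr.
Qed.

(** By [theta_untwist] the terms become [theta] of [psi j (h_1 C_ij)] translated by [e_i]. These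
    maps add up to [x |-> h_1 x], and [theta_unit] concludes. *)
Lemma proj_sectionK h : tens_lift (fun x z => x * v z) (proj_section h) = h.
Proof.
have Mbil := mul_linear_bilinear v.
have Msum := linear_fun_sumE _ _ (tens_lift_linear Mbil).
rewrite /proj_section Msum; under eq_bigr do rewrite Msum.
under eq_bigr do under eq_bigr do rewrite Msum.
under eq_bigr do under eq_bigr do under eq_bigr do rewrite Msum.
under eq_bigr do under eq_bigr do under eq_bigr do
  under eq_bigr do rewrite (tens_liftE Mbil).
pose psiL j h := GRing.isLinear.Build k A H *:%R (psi j h) (psi_linearr j h).
pose psil j h : {linear A -> H} := HB.pack (psi j h) (psiL j h).
under eq_bigr do under eq_bigr do under eq_bigr do rewrite (theta_untwist (psil _ _)).
under eq_bigr do rewrite exchange_big /=.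
rewrite exchange_big /= -[RHS]theta_unit; apply: eq_bigr => p _.
under eq_bigr do rewrite -(linear_fun_sumE _ _ (theta_linearl _)).
rewrite -(linear_fun_sumE _ _ (theta_linearl _)); congr theta.
apply/funext => x; rewrite fct_sumE; under eq_bigr do rewrite fct_sumE.
rewrite /psi -[x in RHS]mulr1 -C1 mulr_sumr linear_sum mulr_sumr.
apply: eq_bigr => j _; transitivity (p.1 * v (\sum_i ec j (e i * x) *: C i j)).
  by rewrite linear_sum mulr_sumr; apply: eq_bigr => i _; rewrite linearZ /= scalerAr.
(* Moving [x] from [e i] back to [C i j] leaves only the term [i = j], namely [x * C j j]; with
   [C1], the sum over [j] is [x]. *)
congr (_ * v _); rewrite -(CA (f := fun y z => ec j z *: y)).
  rewrite (bigD1 j) //= coord_delta eqxx scale1r big1 ?addr0 // => i ij.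
  by rewrite coord_delta (negPf ij) scale0r.
split=> [y c z z'|z c y y']; first by rewrite linearP scalerDl scalerA.
by rewrite scalerDr !scalerA mulrC.
Qed.

Lemma hopf_exact (v1 : v 1 = 1) (N1 N2 N3 : lmodType A)
    (f : {linear N1 -> N2}) (g : {linear N2 -> N3}) :
  exact_at f g ->
  exact_at
    (btens_map idfun f :
      btens (fun (h : H) (a : A) => h * v a) (fun (a : A) (n : N1) => a *: n) ->
      btens (fun (h : H) (a : A) => h * v a) (fun (a : A) (n : N2) => a *: n))
    (btens_map idfun g :
      btens (fun (h : H) (a : A) => h * v a) (fun (a : A) (n : N2) => a *: n) ->
      btens (fun (h : H) (a : A) => h * v a) (fun (a : A) (n : N3) => a *: n)).
Proof. exact: (section_exact v1 proj_section_linear proj_sectionM proj_sectionK). Qed.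

End ProjectiveSection.

Lemma tens_sum (k : comPzRingType) (M N : lmodType k) (t : tens M N) :
  exists s : seq (M * N), t = \sum_(p <- s) tens_pure p.1 p.2.
Proof.
elim/tens_ind: t => [m n|t t' [s ->] [s' ->]].
  by exists [:: (m, n)]; rewrite big_seq1.
by exists (s ++ s'); rewrite big_cat.
Qed.

Lemma tens_pure_bilinear (k : comPzRingType) (M N M' N' : lmodType k)
    (f : M -> M') (g : N -> N') :
  linear f -> linear g -> bilinear_fun (fun m n => tens_pure (f m) (g n)).
Proof.
move=> flin glin; split=> [m c n n'|n c m m'].
  by rewrite glin tens_pureDr tens_pureZr.
by rewrite flin tens_pureDl tens_pureZl.
Qed.

Lemma tens_lift_sum (k : comPzRingType) (M N W : lmodType k) (f : M -> N -> W)
    (s : seq (M * N)) :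
  bilinear_fun f ->
  tens_lift f (\sum_(p <- s) tens_pure p.1 p.2) = \sum_(p <- s) f p.1 p.2.
Proof.
move=> fbil; rewrite (linear_fun_sumE _ _ (tens_lift_linear fbil)).
by apply: eq_bigr => p _; rewrite tens_liftE.
Qed.

(** * Coproducts as finite sums *)

Section HopfCoproduct.
Variables (k : fieldType) (H : hopfAlgType k).

Let comul_seq (h : H) : {s : seq (H * H) | comul h = \sum_(p <- s) tens_pure p.1 p.2}.
Proof. exact/cid/tens_sum. Qed.

(** The list is an arbitrary choice; by [coproduct_lift], sums of bilinear expressions over it
    depend on [comul h] alone. *)
Definition coproduct (h : H) : seq (H * H) := sval (comul_seq h).
Local Notation D := coproduct.

Lemma coproductE h : comul h = \sum_(p <- D h) tens_pure p.1 p.2.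
Proof. exact: svalP (comul_seq h). Qed.

Lemma coproduct_lift (W : lmodType k) (f : H -> H -> W) h :
  bilinear_fun f -> \sum_(p <- D h) f p.1 p.2 = tens_lift f (comul h).
Proof. by move=> fbil; rewrite coproductE tens_lift_sum. Qed.

Lemma coproduct_linear (W : lmodType k) (f : H -> H -> W) :
  bilinear_fun f -> linear (fun h => \sum_(p <- D h) f p.1 p.2).
Proof.
move=> fbil c x y; rewrite !coproduct_lift //.
by rewrite comul_linear (tens_lift_linear fbil).
Qed.

Lemma coproductM (W : lmodType k) (f : H -> H -> W) x y : bilinear_fun f ->
  \sum_(p <- D (x * y)) f p.1 p.2 =
  \sum_(p <- D x) \sum_(q <- D y) f (p.1 * q.1) (p.2 * q.2).
Proof.
move=> fbil; have fsum := linear_fun_sumE _ _ (tens_lift_linear fbil).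
rewrite coproduct_lift // comul_monoid_morphism.2 !coproductE mulr_suml fsum.
apply: eq_bigr => p _; rewrite mulr_sumr fsum.
by apply: eq_bigr => q _; rewrite tens_pure_mul tens_liftE.
Qed.

Lemma coproductA (W : lmodType k) (f : H -> H -> H -> W) h : trilinear_fun f ->
  \sum_(p <- D h) \sum_(q <- D p.1) f q.1 q.2 p.2 =
  \sum_(p <- D h) \sum_(q <- D p.2) f p.1 q.1 q.2.
Proof.
move=> [f1 f2 f3].
have fb l : bilinear_fun (f l) by split=> [m|n]; [exact: f3 | exact: f2].
have Fb : bilinear_fun (fun l => tens_lift (f l)).
  split=> [l|w]; first exact: tens_lift_linear.
  move=> c l l'; elim/tens_ind: w => [m n|w w' IH IH'].
    by rewrite !tens_liftE // f1.
  by rewrite !tens_liftD // IH IH' scalerDr addrACA.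
have idlin (V : lmodType k) : linear (idfun : V -> V) by [].
have ab (n : H) : bilinear_fun (fun l m : H => tens_pure l (tens_pure m n)).
  by split=> [l c m m'|m c l l'];
    rewrite ?tens_pureDl ?tens_pureZl ?tens_pureDr ?tens_pureZr.
have Ab : bilinear_fun (fun (t : tens H H) (n : H) =>
    tens_lift (fun l m => tens_pure l (tens_pure m n)) t).
  split=> [t c n n'|n]; last exact: tens_lift_linear.
  elim/tens_ind: t => [l m|w w' IH IH'].
    by rewrite !tens_liftE // !tens_pureDr !tens_pureZr.
  by rewrite !tens_liftD // IH IH' scalerDr addrACA.
have Asum := linear_fun_sumE _ _ (tens_lift_linear Ab).
(* The map induced by [f] on the triple tensor product is applied to both sides of
   coassociativity. *)
have := congr1 (tens_lift (fun l => tens_lift (f l))) (comulA h).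
have cl : linear (comul : H -> tens H H) := comul_linear.
have -> : tens_assoc (tens_map comul idfun (comul h)) =
    \sum_(p <- D h) \sum_(q <- D p.1) tens_pure q.1 (tens_pure q.2 p.2) :> tens H (tens H H).
  rewrite (coproductE h) [tens_map _ _ _](tens_lift_sum _ (tens_pure_bilinear cl (idlin H))).
  rewrite [LHS]Asum; apply: eq_bigr => p _; rewrite (tens_liftE Ab) coproductE.
  exact: tens_lift_sum.
rewrite {1}(coproductE h) [tens_map _ _ _](tens_lift_sum _ (tens_pure_bilinear (idlin H) cl)).
have Fsum := linear_fun_sumE _ _ (tens_lift_linear Fb).
rewrite !Fsum => E; transitivity (\sum_(p <- D h) \sum_(q <- D p.1) tens_lift
    (fun l => tens_lift (f l)) (tens_pure q.1 (tens_pure q.2 p.2))).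
  by apply: eq_bigr => p _; apply: eq_bigr => q _; rewrite (tens_liftE Fb) tens_liftE.
under eq_bigr do rewrite -Fsum.
rewrite E; apply: eq_bigr => p _; rewrite (tens_liftE Fb).
by rewrite coproduct_lift.
Qed.

Lemma coproduct_counitl h : \sum_(p <- D h) counit p.1 *: p.2 = h.
Proof.
rewrite (coproduct_lift (f := fun x y => counit x *: y)) ?comul_counitl //.
split=> [x c y y'|y c x x']; first by rewrite scalerDr !scalerA mulrC.
by rewrite counit_linear scalerDl scalerA.
Qed.

Lemma coproduct_counitr h : \sum_(p <- D h) counit p.2 *: p.1 = h.
Proof.
rewrite (coproduct_lift (f := fun x y => counit y *: x)) ?comul_counitr //.
split=> [x c y y'|y c x x']; last by rewrite scalerDr !scalerA mulrC.
by rewrite counit_linear scalerDl scalerA.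
Qed.

Lemma coproduct_antipodel h : \sum_(p <- D h) antipode p.1 * p.2 = (counit h)%:A.
Proof.
rewrite (coproduct_lift (f := fun x y => antipode x * y)) ?antipodel //.
split=> [x c y y'|y c x x']; first by rewrite mulrDr -scalerAr.
by rewrite antipode_linear mulrDl -scalerAl.
Qed.

Lemma coproduct_antipoder h : \sum_(p <- D h) p.1 * antipode p.2 = (counit h)%:A.
Proof.
rewrite (coproduct_lift (f := fun x y => x * antipode y)) ?antipoder //.
split=> [x c y y'|y c x x']; last by rewrite mulrDl -scalerAl.
by rewrite antipode_linear mulrDr -scalerAr.
Qed.

(* Both sides are convolution inverses of [fun x y => x * y]. *)
Lemma antipodeM x y : antipode (x * y) = antipode y * antipode x :> H.
Proof.
pose S := @antipode k H.
have Sl : linear S := antipode_linear.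
have SZ c z : S (c *: z) = c *: S z by exact: linear_funZ.
have cl : linear (counit : H -> k^o) := counit_linear.
(* This is [S(x_1 y_1) x_2 y_2 S(y_3) S(x_3)]. Contracting the last four factors gives [S (x * y)];
   contracting the first three gives [S y * S x]. *)
pose Z := \sum_(p <- D x) \sum_(q <- D p.2) \sum_(r <- D y) \sum_(t <- D r.2)
  S (p.1 * r.1) * (q.1 * t.1) * (S t.2 * S q.2).
have Z1 : Z = S (x * y).
  rewrite /Z; transitivity (\sum_(p <- D x) \sum_(r <- D y)
    counit p.2 *: (counit r.2 *: S (p.1 * r.1))).
    apply: eq_bigr => p _; rewrite exchange_big /=; apply: eq_bigr => r _.
    transitivity (\sum_(q <- D p.2) S (p.1 * r.1) * (q.1 * (counit r.2)%:A * S q.2)).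
      apply: eq_bigr => q _; rewrite -coproduct_antipoder mulr_sumr mulr_suml mulr_sumr.
      by apply: eq_bigr => t _; rewrite !mulrA.
    under eq_bigr do rewrite -scalerAr mulr1 -scalerAl -scalerAr.
    rewrite -scaler_sumr -mulr_sumr coproduct_antipoder -scalerAr mulr1.
    by rewrite scalerA mulrC -scalerA.
  transitivity (S ((\sum_(p <- D x) counit p.2 *: p.1) * (\sum_(r <- D y) counit r.2 *: r.1))).
    rewrite mulr_suml (linear_fun_sumE _ _ Sl); apply: eq_bigr => p _.
    rewrite mulr_sumr (linear_fun_sumE _ _ Sl); apply: eq_bigr => r _.
    by rewrite -scalerAl -scalerAr !SZ.
  by rewrite !coproduct_counitr.
have Z2 : Z = S y * S x.
  transitivity (\sum_(p <- D x) \sum_(r <- D y) counit (p.1 * r.1) *: (S r.2 * S p.2)).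
    pose f a b c := \sum_(r <- D y) \sum_(t <- D r.2) S (a * r.1) * (b * t.1) * (S t.2 * S c).
    rewrite /Z -(coproductA (f := f)).
      apply: eq_bigr => p _.
      transitivity (\sum_(q <- D p.1) \sum_(r <- D y) \sum_(t <- D r.1)
          S (q.1 * t.1) * (q.2 * t.2) * (S r.2 * S p.2)).
        apply: eq_bigr => q _.
        rewrite (coproductA (f := fun a b c => S (q.1 * a) * (q.2 * b) * (S c * S p.2))) //.
        split=> [b c d a a'|a c d b b'|a b d c c'].
        - by rewrite mulrDr -scalerAr Sl !mulrDl -!scalerAl.
        - by rewrite !mulrDr -!scalerAr !mulrDl -!scalerAl.
        - by rewrite Sl mulrDl mulrDr -scalerAl -scalerAr.
      rewrite exchange_big /=; apply: eq_bigr => r _.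
      rewrite -[_ *: (_ * _)]mul1r -scalerAr scalerAl -coproduct_antipodel.
      rewrite (coproductM (f := fun a b => S a * b)).
        by rewrite mulr_suml; apply: eq_bigr => q _; rewrite mulr_suml.
      split=> [a c b b'|b c a a']; first by rewrite mulrDr -scalerAr.
      by rewrite Sl mulrDl -scalerAl.
    split=> [b c d a a'|a c d b b'|a b d c c']; rewrite /f scaler_sumr -big_split /=;
      apply: eq_bigr => r _; rewrite scaler_sumr -big_split /=; apply: eq_bigr => t _.
    - by rewrite mulrDl -scalerAl Sl !mulrDl -!scalerAl.
    - by rewrite mulrDl mulrDr -scalerAl -scalerAr mulrDl -scalerAl.
    - by rewrite Sl !mulrDr -!scalerAr.
  transitivity (S (\sum_(r <- D y) counit r.1 *: r.2) * S (\sum_(p <- D x) counit p.1 *: p.2)).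
    rewrite exchange_big !(linear_fun_sumE _ _ Sl) mulr_suml; apply: eq_bigr => r _.
    rewrite mulr_sumr; apply: eq_bigr => p _.
    by rewrite !SZ -scalerAl -scalerAr scalerA counit_monoid_morphism.2 mulrC.
  by rewrite !coproduct_counitl.
by rewrite -/S -Z1.
Qed.
End HopfCoproduct.

Lemma linear_left_inverse (k : fieldType) (V W : lmodType k) (f : {linear V -> W}) :
  injective f -> exists g : {linear W -> V}, cancel f g.
Proof.
move=> finj; have [g gf] := linear_quasi_inverse f; exists g => x.
by apply/esym/eqP; rewrite -subr_eq0; apply/eqP/finj; rewrite gf linear0.
Qed.

(** * Balanced forms from flatness *)

(** The assumption on [w] says that [b0] vanishes on the kernel of the map from [L (x) K] to the
    product of [G] and [K] balanced over both [k] and [R]. Hence [b0] descends to the image of this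
    map, and a functional on a subspace extends to the whole space. *)
Lemma balanced_extension (k : fieldType) (L G K : lmodType k) (R : Type)
    (ract : G -> R -> G) (lact : R -> K -> K) (u : L -> G) (b0 : L -> K -> k^o) :
  linear u -> (forall r, linear (ract^~ r)) -> bilinear_fun b0 ->
  (forall w : tens L K,
    (forall (W : zmodType) (beta : G -> K -> W),
       balanced (fun (g : G) (c : k) => c *: g) (fun c y => c *: y) beta ->
       balanced ract lact beta -> tens_lift beta (tens_map u idfun w) = 0) ->
    tens_lift b0 w = 0) ->
  exists b : G -> K -> k^o, [/\ bilinear_fun b,
    forall g r y, b (ract g r) y = b g (lact r y) & forall x y, b (u x) y = b0 x y].
Proof.
move=> ulin rlin b0bil b0z.
have idl : linear (idfun : K -> K) by [].
have ulin' : linear (tens_map u idfun : tens L K -> tens G K).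
  exact: (tens_lift_linear (tens_pure_bilinear ulin idl)).
(* The kernel of the passage to the balanced product, described by its universal property. *)
pose small (t : tens G K) := forall (W : zmodType) (beta : G -> K -> W),
  balanced (fun (g : G) (c : k) => c *: g) (fun c y => c *: y) beta ->
  balanced ract lact beta -> tens_lift beta t = 0.
have smallD t t' : small t -> small t' -> small (t + t').
  move=> st st' W beta kb rb.
  by rewrite [LHS](btens_liftD kb) [X in X + _]st // [X in _ + X]st' // addr0.
have smallZ c t : small t -> small (c *: t).
  move=> st W beta kb rb; have [kDl kDr kA] := kb; have [rDl rDr rA] := rb.
  (* The target [W] carries no scalars, so [c] is moved into the form: [beta (c *: g) y] is again
     balanced, by linearity of [ract] for the relations over [R]. *)
  have kb' : balanced (fun (g : G) (c : k) => c *: g) (fun c y => c *: y)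
      (fun g y => beta (c *: g) y).
    split=> [g g' y|g y y'|g c' y]; first by rewrite scalerDr kDl.
      exact: kDr.
    by rewrite scalerA mulrC -scalerA kA.
  rewrite -(st W (fun g y => beta (c *: g) y) kb').
    elim/tens_ind: t {st} => [g y|t t' IH IH'].
      by rewrite -tens_pureZl [LHS](btens_liftE kb) [RHS](btens_liftE kb').
    by rewrite scalerDr [LHS](btens_liftD kb) [RHS](btens_liftD kb') [X in X + _]IH [X in _ + X]IH'.
  split=> [g g' y|g y y'|g r y]; first by rewrite scalerDr kDl.
    exact: kDr.
  by rewrite -(linear_funZ _ _ (rlin r)) rA.
pose X := [set x : tens G K * k^o | exists w : tens L K,
  small (x.1 - tens_map u idfun w) /\ x.2 = tens_lift b0 w].
have small0 : small 0.
  move=> W beta kb _; apply: (addIr (tens_lift beta 0)).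
  by rewrite -[LHS](btens_liftD kb) !add0r.
have map0 : tens_map u idfun (0 : tens L K) = 0.
  by have := linear_funZ 0 0 ulin'; rewrite !scale0r.
have b0lin : linear (tens_lift b0 : tens L K -> k^o) := tens_lift_linear b0bil.
have b00 : tens_lift b0 0 = 0 by have := linear_funZ 0 0 b0lin; rewrite !scale0r.
have [||//|c [w [/= sw ->]]|t|g [_ gE]] := @linear_selection k (tens G K) k^o setT X.
- by split.
- split=> [|c [t _] [t' _] [w [/= sw ->]] [w' [/= sw' ->]]].
    by exists 0; rewrite map0 b00 subr0.
  exists (c *: w + w'); rewrite /= ulin' b0lin; split=> //.
  by rewrite opprD addrACA -scalerBr; apply/smallD/sw'/smallZ.
- apply: b0z => W beta kb rb; have := smallZ (-1) _ sw W beta kb rb.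
  by rewrite scaleN1r sub0r opprK.
- by exists 0.
exists (fun x y => g (tens_pure x y)); split=> [|x r y|x y].
- split=> [x c y y'|y c x x'].
    by rewrite tens_pureDr tens_pureZr linearP.
  by rewrite tens_pureDl tens_pureZl linearP.
- apply/eqP; rewrite -subr_eq0 -raddfB; apply/eqP/gE; exists 0.
  rewrite /= map0 b00 subr0; split=> // W beta kb rb; have [_ _ rA] := rb.
  rewrite -scaleN1r -tens_pureZl [LHS](btens_liftD kb) 2!(btens_liftE kb) rA.
  have [kDl _ _] := kb; rewrite -kDl scaleN1r subrr.
  by apply: (addIr (beta 0 (lact r y))); rewrite -kDl !add0r.
- apply: gE; exists (tens_pure x y); rewrite /=.
  rewrite [tens_map _ _ _](tens_liftE (tens_pure_bilinear ulin idl)) subrr tens_liftE //.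
Qed.

(** Injectivity of [u] is exactness after the zero map, for which the zero endomorphism of [N]
    serves; tensoring it gives zero again. *)
Lemma flat_left_injective (R : pzRingType) (M : lmodType R) (N N' : lmodType R^c)
    (u : {linear N -> N'}) :
  flat_left_module M -> injective u -> forall t, tensl_map (M := M) u t = 0 -> t = 0.
Proof.
move=> flatM uinj t ut0.
pose z : {linear N -> N} := [the {linear N -> N} of \0].
have zu : exact_at z u.
  by move=> x; split=> [ux|[w <-]]; [exists 0; apply: uinj; rewrite ux linear0 | rewrite linear0].
have /(flatM _ _ _ z u zu) [w <-] := ut0.
have bal : balanced (fun (m : N) (r : R) => (r : R^c) *: m) (fun r (n : M) => r *: n)
    (fun m n => btens_pure _ _ (z m) (idfun n) : module_tens N M).
  split=> [m m' n|m n n'|m r n]; rewrite /= ?btens_pureDr //.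
    by rewrite -btens_pureDl addr0.
  by rewrite -btens_pure_act scaler0.
have pure0 n : btens_pure _ _ 0 n = 0 :> module_tens N M.
  have := btens_pureDl (fun (m : N) (r : R) => (r : R^c) *: m) (fun r (n : M) => r *: n) 0 0 n.
  by rewrite addr0 => /esym/eqP; rewrite -subr_eq0 addrK => /eqP.
elim/btens_ind: w => [m n|w w' IH IH']; first exact: etrans (btens_liftE bal m n) (pure0 n).
by apply: etrans (btens_liftD bal w w') _; rewrite [X in X + _]IH [X in _ + X]IH' addr0.
Qed.

Lemma flat_right_injective (R : pzRingType) (M : lmodType R^c) (N N' : lmodType R)
    (u : {linear N -> N'}) :
  flat_right_module M -> injective u -> forall t, tensr_map (M := M) u t = 0 -> t = 0.
Proof.
move=> flatM uinj t ut0.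
pose z : {linear N -> N} := [the {linear N -> N} of \0].
have zu : exact_at z u.
  by move=> x; split=> [ux|[w <-]]; [exists 0; apply: uinj; rewrite ux linear0 | rewrite linear0].
have /(flatM _ _ _ z u zu) [w <-] := ut0.
have bal : balanced (fun (n : M) (r : R) => (r : R^c) *: n) (fun r (m : N) => r *: m)
    (fun n m => btens_pure _ _ (idfun n) (z m) : module_tens M N).
  split=> [n n' m|n m m'|n r m]; rewrite /= ?btens_pureDl //.
    by rewrite -btens_pureDr addr0.
  by rewrite btens_pure_act scaler0.
have pure0 n : btens_pure _ _ n 0 = 0 :> module_tens M N.
  have := btens_pureDr (fun (n : M) (r : R) => (r : R^c) *: n) (fun r (m : N) => r *: m) n 0 0.
  by rewrite addr0 => /esym/eqP; rewrite -subr_eq0 addrK => /eqP.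
elim/btens_ind: w => [n m|w w' IH IH']; first exact: etrans (btens_liftE bal n m) (pure0 n).
by apply: etrans (btens_liftD bal w w') _; rewrite [X in X + _]IH [X in _ + X]IH' addr0.
Qed.

Section FlatForm.
Variables (k : fieldType) (H A : algType k) (v : {rmorphism A -> H}) (B : coordinates A).
Hypothesis vlin : linear v.
Variable eps : {linear H -> k^o}.
Local Notation e := (coord_vec B).
Local Notation ec := (coord_fun B).

(** The functional [eps (x * y)] is balanced over [A], so it factors through the tensor product of
    [H] with itself over [A]. By flatness, [u] embeds this product into the one of [G] and [H], and
    [balanced_extension] applies. *)
Lemma flat_left_form : flat_left_module (left_restriction v) ->
  exists b : (A -> H) -> H -> k^o, [/\ bilinear_fun b,
    forall phi a y, linear phi -> b (fun x => phi (a * x)) y = b phi (v a * y) &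
    forall h y, b (fun x => h * v x) y = eps (h * y)].
Proof.
move=> flatH.
(* Over the converse algebra the action on [coinduced] becomes [phi (a * x)], the right module
   structure wanted on linear maps from [A] to [H]. *)
pose Bc : coordinates (A^c : algType k) := B.
pose G : lmodType A^c := coinduced Bc H.
pose u (x : right_restriction v) : G := fun n => (x : H) * v (e n).
have ulin : linear u.
  move=> a x y; transitivity (a *: ((fun z : A => (x : H) * v z) \o e : G) + u y); last by [].
  rewrite (coinduced_scaleE (A := A^c)); last by move=> c z z'; rewrite vlin mulrDr -scalerAr.
  apply/funext => n; rewrite -[RHS]/(_ + _) -[LHS]/(((x : H) * v a + (y : H)) * v (e n)).
  by rewrite mulrDl -mulrA -rmorphM.
pose uB := GRing.isLinear.Build A^c (right_restriction v) G *:%R u ulin.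
pose uL : {linear right_restriction v -> G} := HB.pack u uB.
have uinj : injective uL.
  move=> x y xy; have xyn n : (x : H) * v (e n) = (y : H) * v (e n) :=
    congr1 (fun phi => phi n) xy.
  rewrite -[LHS](mulr1 (x : H)) -[RHS](mulr1 (y : H)) -(rmorph1 v) -(coord_sum B 1).
  rewrite (linear_fun_sumE _ _ vlin) !mulr_sumr; apply: eq_bigr => n _.
  by rewrite (linear_funZ _ _ vlin) -!scalerAr xyn.
have inj := flat_left_injective flatH uinj.
(* The functions underlying [G], with their pointwise structure over [k]. *)
pose Gk : lmodType k := 'I_(coord_dim B) -> H.
pose ract (g : Gk) (a : A) : Gk := (a : A^c) *: (g : G).
pose lact (a : A) (y : H) := v a * y.
pose b0 (x y : H) : k^o := eps (x * y).
have ulink : linear (u : H -> Gk).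
  by move=> c x y; apply/funext => n; rewrite /u mulrDl -scalerAl.
have rlin a : linear (ract^~ a).
  move=> c g g'; apply/funext => n.
  rewrite -[LHS]/(\sum_m ec m (a * e n) *: (c *: g m + g' m)).
  rewrite -[RHS]/(c *: (\sum_m ec m (a * e n) *: g m) + \sum_m ec m (a * e n) *: g' m).
  rewrite scaler_sumr -big_split; apply: eq_bigr => m _.
  by rewrite scalerDr !scalerA mulrC.
have b0bil : bilinear_fun b0.
  split=> [x c y y'|y c x x']; first by rewrite /b0 mulrDr -scalerAr linearP.
  by rewrite /b0 mulrDl -scalerAl linearP.
have scalarl c (y : H) : lact c%:A y = c *: y.
  by rewrite /lact (linear_funZ _ _ vlin) rmorph1 -scalerAl mul1r.
have scalarr c (y : H) : y * v c%:A = c *: y.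
  by rewrite (linear_funZ _ _ vlin) rmorph1 -scalerAr mulr1.
have [|b [bbil bA bv]] := balanced_extension ulink rlin b0bil (lact := lact).
  move=> w hw.
  pose P (x y : H) : module_tens (right_restriction v) (left_restriction v) :=
    btens_pure _ _ (x : right_restriction v) (y : left_restriction v).
  pose beta (g : Gk) (y : H) : module_tens G (left_restriction v) :=
    btens_pure _ _ (g : G) (y : left_restriction v).
  have betaA : balanced ract lact beta.
    by split=> [g g' y|g y y'|g a y]; rewrite /beta ?btens_pureDl ?btens_pureDr ?btens_pure_act.
  have betak : balanced (fun (g : Gk) (c : k) => c *: g) (fun (c : k) (y : H) => c *: y) beta.
    split=> [g g' y|g y y'|g c y]; rewrite /beta ?btens_pureDl ?btens_pureDr //.
    by rewrite -[c *: y]scalarl -btens_pure_act (coinduced_scalar (A := A^c)).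
  have Pk : balanced (fun (x : H) (c : k) => c *: x) (fun (c : k) (y : H) => c *: y) P.
    split=> [x x' y|x y y'|x c y]; rewrite /P ?btens_pureDl ?btens_pureDr //.
    by rewrite -[c *: y]scalarl -btens_pure_act -[c *: x]scalarr.
  have b0A : balanced (fun (x : right_restriction v) (a : A) => (a : A^c) *: x)
      (fun (a : A) (y : left_restriction v) => a *: y)
      (fun x y => b0 x y).
    split=> [x x' y|x y y'|x a y]; rewrite /b0 ?mulrDl ?mulrDr ?linearD //.
    by congr (eps _); rewrite -[LHS]/((x : H) * v a * (y : H)) -mulrA.
  have b0k := bilinear_balanced b0bil.
  have uk := bilinear_balanced (tens_pure_bilinear ulink (fun c (x y : H) => erefl (c *: x + y))).
  have ub : balanced (fun (x : right_restriction v) (a : A) => (a : A^c) *: x)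
      (fun (a : A) (y : left_restriction v) => a *: y)
      (fun x y => btens_pure _ _ (uL x) (idfun y) : module_tens G (left_restriction v)).
    split=> [x x' y|x y y'|x a y]; rewrite ?linearD ?btens_pureDl ?btens_pureDr //.
    by rewrite linearZ btens_pure_act.
  (* The class of [w] over [A] is sent by [u] to its value under [beta], which is zero by [hw];
     injectivity makes the class itself zero. *)
  have P0 : tens_lift P w = 0.
    apply: inj; rewrite -(hw _ beta betak betaA).
    elim/tens_ind: w {hw} => [x y|w w' IH IH'].
      rewrite [tens_lift P _](btens_liftE Pk) [LHS](btens_liftE ub).
      by rewrite [tens_map _ _ _](btens_liftE uk) [RHS](btens_liftE betak).
    rewrite [tens_lift P _](btens_liftD Pk) [LHS](btens_liftD ub) [X in X + _]IH [X in _ + X]IH'.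
    by rewrite [tens_map u _ (_ + _)](btens_liftD uk) [RHS](btens_liftD betak).
  transitivity (btens_lift (fun x y => b0 x y) (tens_lift P w) : k^o).
    elim/tens_ind: w {hw P0} => [x y|w w' IH IH'].
      by rewrite [tens_lift P _](btens_liftE Pk) [LHS](btens_liftE b0k) [RHS](btens_liftE b0A).
    rewrite [tens_lift P _](btens_liftD Pk) [RHS](btens_liftD b0A) -IH -IH'.
    exact: (btens_liftD b0k).
  rewrite P0; apply: (addIr (btens_lift (fun x y => b0 x y)
    (0 : module_tens (right_restriction v) (left_restriction v)))).
  by rewrite -[LHS](btens_liftD b0A) !add0r.
(* An arbitrary function [phi] enters through its values on the basis only, which explains why [phi]
   has to be linear in the second property. *)
exists (fun phi y => b (fun n => phi (e n)) y); split=> [|phi a y phil|h y]; last exact: bv.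
- by split=> [phi|y c phi psi]; [exact: bbil.1 | exact: bbil.2].
- rewrite -bA; congr b; apply/funext => n.
  exact/esym/(congr1 (fun phi => phi n) (coinduced_scaleE (A := A^c) Bc a phil)).
Qed.

(** The mirror image of [flat_left_form]: the linear maps now form the right-hand factor of the
    product over [A], while remaining the first argument of [b]. *)
Lemma flat_right_form : flat_right_module (right_restriction v) ->
  exists b : (A -> H) -> H -> k^o, [/\ bilinear_fun b,
    forall phi a y, linear phi -> b (fun x => phi (x * a)) y = b phi (y * v a) &
    forall h y, b (fun x => v x * h) y = eps (y * h)].
Proof.
move=> flatH.
pose G : lmodType A := coinduced B H.
pose u (x : left_restriction v) : G := fun n => v (e n) * (x : H).
have ulin : linear u.
  move=> a x y; transitivity (a *: ((fun z : A => v z * (x : H)) \o e : G) + u y); last by [].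
  rewrite coinduced_scaleE; last by move=> c z z'; rewrite vlin mulrDl -scalerAl.
  apply/funext => n; rewrite -[RHS]/(_ + _) -[LHS]/(v (e n) * (v a * (x : H) + (y : H))).
  by rewrite mulrDr mulrA -rmorphM.
pose uB := GRing.isLinear.Build A (left_restriction v) G *:%R u ulin.
pose uL : {linear left_restriction v -> G} := HB.pack u uB.
have uinj : injective uL.
  move=> x y xy; have xyn n : v (e n) * (x : H) = v (e n) * (y : H) :=
    congr1 (fun phi => phi n) xy.
  rewrite -[LHS](mul1r (x : H)) -[RHS](mul1r (y : H)) -(rmorph1 v) -(coord_sum B 1).
  rewrite (linear_fun_sumE _ _ vlin) !mulr_suml; apply: eq_bigr => n _.
  by rewrite (linear_funZ _ _ vlin) -!scalerAl xyn.
have inj := flat_right_injective flatH uinj.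
pose Gk : lmodType k := 'I_(coord_dim B) -> H.
pose ract (g : Gk) (a : A) : Gk := a *: (g : G).
pose lact (a : A) (y : H) := y * v a.
pose b0 (x y : H) : k^o := eps (y * x).
have ulink : linear (u : H -> Gk).
  by move=> c x y; apply/funext => n; rewrite /u mulrDr -scalerAr.
have rlin a : linear (ract^~ a).
  move=> c g g'; apply/funext => n.
  rewrite -[LHS]/(\sum_m ec m (e n * a) *: (c *: g m + g' m)).
  rewrite -[RHS]/(c *: (\sum_m ec m (e n * a) *: g m) + \sum_m ec m (e n * a) *: g' m).
  rewrite scaler_sumr -big_split; apply: eq_bigr => m _.
  by rewrite scalerDr !scalerA mulrC.
have b0bil : bilinear_fun b0.
  split=> [x c y y'|y c x x']; last by rewrite /b0 mulrDr -scalerAr linearP.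
  by rewrite /b0 mulrDl -scalerAl linearP.
have scalarr c (y : H) : lact c%:A y = c *: y.
  by rewrite /lact (linear_funZ _ _ vlin) rmorph1 -scalerAr mulr1.
have scalarl c (y : H) : v c%:A * y = c *: y.
  by rewrite (linear_funZ _ _ vlin) rmorph1 -scalerAl mul1r.
have [|b [bbil bA bv]] := balanced_extension ulink rlin b0bil (lact := lact).
  move=> w hw.
  pose P (x y : H) : module_tens (right_restriction v) (left_restriction v) :=
    btens_pure _ _ (y : right_restriction v) (x : left_restriction v).
  pose beta (g : Gk) (y : H) : module_tens (right_restriction v) G :=
    btens_pure _ _ (y : right_restriction v) (g : G).
  have betaA : balanced ract lact beta.
    by split=> [g g' y|g y y'|g a y]; rewrite /beta ?btens_pureDl ?btens_pureDr -?btens_pure_act.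
  have betak : balanced (fun (g : Gk) (c : k) => c *: g) (fun (c : k) (y : H) => c *: y) beta.
    split=> [g g' y|g y y'|g c y]; rewrite /beta ?btens_pureDl ?btens_pureDr //.
    by rewrite -[c *: y]scalarr [RHS]btens_pure_act coinduced_scalar.
  have Pk : balanced (fun (x : H) (c : k) => c *: x) (fun (c : k) (y : H) => c *: y) P.
    split=> [x x' y|x y y'|x c y]; rewrite /P ?btens_pureDl ?btens_pureDr //.
    by rewrite -[c *: y]scalarr [RHS]btens_pure_act -[c *: x]scalarl.
  have b0A : balanced (fun (x : right_restriction v) (a : A) => (a : A^c) *: x)
      (fun (a : A) (y : left_restriction v) => a *: y)
      (fun y x => b0 x y).
    split=> [x x' y|x y y'|x a y]; rewrite /b0 ?mulrDl ?mulrDr ?linearD //.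
    by congr (eps _); rewrite -[LHS]/((x : H) * v a * (y : H)) -mulrA.
  have b0k := bilinear_balanced b0bil.
  have uk := bilinear_balanced (tens_pure_bilinear ulink (fun c (x y : H) => erefl (c *: x + y))).
  have ub : balanced (fun (x : right_restriction v) (a : A) => (a : A^c) *: x)
      (fun (a : A) (y : left_restriction v) => a *: y)
      (fun y x => btens_pure _ _ (idfun y) (uL x) : module_tens (right_restriction v) G).
    split=> [x x' y|x y y'|x a y]; rewrite ?linearD ?btens_pureDl ?btens_pureDr //.
    by rewrite [LHS]btens_pure_act linearZ.
  have P0 : tens_lift P w = 0.
    apply: inj; rewrite -(hw _ beta betak betaA).
    elim/tens_ind: w {hw} => [x y|w w' IH IH'].
      rewrite [tens_lift P _](btens_liftE Pk) [LHS](btens_liftE ub).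
      by rewrite [tens_map _ _ _](btens_liftE uk) [RHS](btens_liftE betak).
    rewrite [tens_lift P _](btens_liftD Pk) [LHS](btens_liftD ub) [X in X + _]IH [X in _ + X]IH'.
    by rewrite [tens_map u _ (_ + _)](btens_liftD uk) [RHS](btens_liftD betak).
  transitivity (btens_lift (fun y x => b0 x y) (tens_lift P w) : k^o).
    elim/tens_ind: w {hw P0} => [x y|w w' IH IH'].
      by rewrite [tens_lift P _](btens_liftE Pk) [LHS](btens_liftE b0k) [RHS](btens_liftE b0A).
    rewrite [tens_lift P _](btens_liftD Pk) [RHS](btens_liftD b0A) -IH -IH'.
    exact: (btens_liftD b0k).
  rewrite P0; apply: (addIr (btens_lift (fun y x => b0 x y)
    (0 : module_tens (right_restriction v) (left_restriction v)))).
  by rewrite -[LHS](btens_liftD b0A) !add0r.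
exists (fun phi y => b (fun n => phi (e n)) y); split=> [|phi a y phil|h y]; last exact: bv.
- by split=> [phi|y c phi psi]; [exact: bbil.1 | exact: bbil.2].
- rewrite -bA; congr b; apply/funext => n.
  exact/esym/(congr1 (fun phi => phi n) (coinduced_scaleE B a phil)).
Qed.
End FlatForm.

(** * Exchanging the factors of a balanced product *)

Section Swap.
Variables (R : Type) (M : zmodType) (ract : M -> R -> M).
Local Notation T lact := (btens ract lact).
Local Notation T' lact := (btens (fun n r => lact r n) (fun r m => ract m r)).

(** The flip is an isomorphism natural in the second factor, so it transports exactness. It is
    needed because [hopf_exact] always has [H] as the first factor. *)
Lemma exact_swap (N1 N2 N3 : zmodType) (l1 : R -> N1 -> N1) (l2 : R -> N2 -> N2)
    (l3 : R -> N3 -> N3) (f : {additive N1 -> N2}) (g : {additive N2 -> N3}) :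
  (forall r n, f (l1 r n) = l2 r (f n)) -> (forall r n, g (l2 r n) = l3 r (g n)) ->
  exact_at (btens_map idfun f : T l1 -> T l2) (btens_map idfun g : T l2 -> T l3) ->
  exact_at (btens_map f idfun : T' l1 -> T' l2) (btens_map g idfun : T' l2 -> T' l3).
Proof.
move=> fl gl fg.
have swap_bal (N : zmodType) (l : R -> N -> N) : balanced ract l
    (fun m n => btens_pure (fun n r => l r n) (fun r m => ract m r) n m).
  by split=> [m m' n|m n n'|m r n]; rewrite ?btens_pureDl ?btens_pureDr ?btens_pure_act.
have swap_bal' (N : zmodType) (l : R -> N -> N) :
    balanced (fun n r => l r n) (fun r m => ract m r) (fun n m => btens_pure ract l m n).
  by split=> [m m' n|m n n'|m r n]; rewrite ?btens_pureDl ?btens_pureDr ?btens_pure_act.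
pose sw (N : zmodType) (l : R -> N -> N) : T l -> T' l :=
  btens_lift (fun m (n : N) => btens_pure (fun n r => l r n) (fun r m => ract m r) n m).
pose sw' (N : zmodType) (l : R -> N -> N) : T' l -> T l :=
  btens_lift (fun (n : N) m => btens_pure ract l m n).
have swK (N : zmodType) (l : R -> N -> N) : cancel (sw N l) (sw' N l).
  elim/btens_ind => [m n|t t' IH IH'].
    by rewrite /sw (btens_liftE (swap_bal N l)) /sw' (btens_liftE (swap_bal' N l)).
  by rewrite /sw (btens_liftD (swap_bal N l)) /sw' (btens_liftD (swap_bal' N l))
    [X in X + _]IH [X in _ + X]IH'.
have sw'K (N : zmodType) (l : R -> N -> N) : cancel (sw' N l) (sw N l).
  elim/btens_ind => [n m|t t' IH IH'].
    by rewrite /sw' (btens_liftE (swap_bal' N l)) /sw (btens_liftE (swap_bal N l)).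
  by rewrite /sw' (btens_liftD (swap_bal' N l)) /sw (btens_liftD (swap_bal N l))
    [X in X + _]IH [X in _ + X]IH'.
have nat (N N' : zmodType) (l : R -> N -> N) (l' : R -> N' -> N') (h : {additive N -> N'})
    (t : T l) : (forall r n, h (l r n) = l' r (h n)) ->
    sw N' l' (btens_map idfun h t) = btens_map h idfun (sw N l t).
  move=> hl.
  have hb : balanced ract l (fun m n => btens_pure ract l' (idfun m) (h n)).
    by split=> [m m' n|m n n'|m r n];
      rewrite ?raddfD ?btens_pureDl ?btens_pureDr ?hl ?btens_pure_act.
  have hb' : balanced (fun n r => l r n) (fun r m => ract m r)
      (fun n m => btens_pure (fun n r => l' r n) (fun r m => ract m r) (h n) (idfun m)).
    by split=> [m m' n|m n n'|m r n];
      rewrite ?raddfD ?btens_pureDl ?btens_pureDr ?hl ?btens_pure_act.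
  elim/btens_ind: t => [m n|t t' IH IH'].
    rewrite [btens_map idfun h _](btens_liftE hb) /sw !(btens_liftE (swap_bal _ _)).
    by rewrite [RHS](btens_liftE hb').
  rewrite [btens_map idfun h _](btens_liftD hb) /sw !(btens_liftD (swap_bal _ _)).
  by rewrite [RHS](btens_liftD hb') [X in X + _]IH [X in _ + X]IH'.
have sw0 (N : zmodType) (l : R -> N -> N) : sw N l 0 = 0.
  by apply: (addIr (sw N l 0)); rewrite -[LHS](btens_liftD (swap_bal N l)) !add0r.
move=> t; rewrite -(sw'K _ _ t) -nat // -(sw0 _ l3).
split=> [/(can_inj (swK _ _))/fg [u <-]|[u]].
  by exists (sw _ _ u); rewrite nat.
rewrite -(sw'K _ _ u) -nat // => /(can_inj (swK _ _)) ut; congr (sw _ _ _).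
by apply/fg; exists (sw' _ _ u).
Qed.
End Swap.

(** * Faithful flatness from a retraction *)

Section FaithfullyFlat.
Variables (R : pzRingType).

(** The map [n |-> n (x) m0] embeds [N] naturally into [N (x) M], with natural retraction
    [n (x) m |-> n rho(m)]. Thus the original sequence is a retract of the tensored one and inherits
    its exactness. *)
Lemma left_split_faithfully_flat (M : lmodType R) (m0 : M) (rho : {linear M -> R^o}) :
  rho m0 = 1 -> flat_left_module M -> faithfully_flat_left_module M.
Proof.
move=> rho1 flatM N1 N2 N3 f g; split; first exact: flatM.
have map_bal (N N' : lmodType R^c) (l : {linear N -> N'}) :
    balanced (fun (n : N) (r : R) => (r : R^c) *: n) (fun r (m : M) => r *: m)
      (fun n m => btens_pure _ _ (l n) (idfun m) : module_tens N' M).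
  split=> [n n' m|n m m'|n r m]; rewrite ?linearD ?btens_pureDl ?btens_pureDr //.
  by rewrite linearZ btens_pure_act.
have ret_bal (N : lmodType R^c) :
    balanced (fun (n : N) (r : R) => (r : R^c) *: n) (fun r (m : M) => r *: m)
      (fun n m => (rho m : R^c) *: n).
  split=> [n n' m|n m m'|n r m]; first exact: scalerDr.
    by rewrite linearD -scalerDl.
  by rewrite scalerA linearZ.
pose ret (N : lmodType R^c) (t : module_tens N M) : N :=
  btens_lift (fun n m => (rho m : R^c) *: n) t.
have ret1 (N : lmodType R^c) n : ret N (btens_pure _ _ n m0) = n.
  by rewrite /ret (btens_liftE (ret_bal N)) rho1 scale1r.
have retM (N N' : lmodType R^c) (l : {linear N -> N'}) t :
    ret N' (tensl_map l t) = l (ret N t).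
  elim/btens_ind: t => [n m|t t' IH IH'].
    by rewrite [tensl_map _ _](btens_liftE (map_bal _ _ l)) /ret !(btens_liftE (ret_bal _)) linearZ.
  rewrite [tensl_map _ _](btens_liftD (map_bal _ _ l)) /ret !(btens_liftD (ret_bal _)) linearD.
  by rewrite [X in X + _]IH [X in _ + X]IH'.
have ret0 (N : lmodType R^c) : ret N 0 = 0.
  by apply: (addIr (ret N 0)); rewrite -[LHS](btens_liftD (ret_bal N)) !add0r.
have pure0 (N : lmodType R^c) : btens_pure _ _ 0 m0 = 0 :> module_tens N M.
  apply: (addIr (btens_pure (fun (n : N) (r : R) => (r : R^c) *: n) (fun r (m : M) => r *: m) 0 m0)).
  by rewrite -[LHS]btens_pureDl !add0r.
move=> fg n; split=> [gn0|[x <-]].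
  have /fg [t tE] : tensl_map (M := M) g (btens_pure _ _ n m0) = 0.
    by rewrite [LHS](btens_liftE (map_bal _ _ g)) gn0.
  by exists (ret _ t); rewrite -retM tE ret1.
have /(congr1 (ret N3)) : tensl_map (M := M) g (tensl_map f (btens_pure _ _ x m0)) = 0.
  by apply/fg; exists (btens_pure _ _ x m0).
by rewrite !retM ret1 ret0.
Qed.

Lemma right_split_faithfully_flat (M : lmodType R^c) (m0 : M) (rho : {linear M -> (R^c)^o}) :
  rho m0 = 1 -> flat_right_module M -> faithfully_flat_right_module M.
Proof.
move=> rho1 flatM N1 N2 N3 f g; split; first exact: flatM.
have map_bal (N N' : lmodType R) (l : {linear N -> N'}) :
    balanced (fun (m : M) (r : R) => (r : R^c) *: m) (fun r (n : N) => r *: n)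
      (fun m n => btens_pure _ _ (idfun m) (l n) : module_tens M N').
  split=> [m m' n|m n n'|m r n]; rewrite ?linearD ?btens_pureDl ?btens_pureDr //.
  by rewrite [LHS]btens_pure_act linearZ.
have ret_bal (N : lmodType R) :
    balanced (fun (m : M) (r : R) => (r : R^c) *: m) (fun r (n : N) => r *: n)
      (fun m n => (rho m : R) *: n).
  split=> [m m' n|m n n'|m r n]; last by rewrite scalerA linearZ.
    by rewrite linearD -scalerDl.
  exact: scalerDr.
pose ret (N : lmodType R) (t : module_tens M N) : N :=
  btens_lift (fun m n => (rho m : R) *: n) t.
have ret1 (N : lmodType R) n : ret N (btens_pure _ _ m0 n) = n.
  by rewrite /ret (btens_liftE (ret_bal N)) rho1 scale1r.
have retM (N N' : lmodType R) (l : {linear N -> N'}) t :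
    ret N' (tensr_map l t) = l (ret N t).
  elim/btens_ind: t => [n m|t t' IH IH'].
    by rewrite [tensr_map _ _](btens_liftE (map_bal _ _ l)) /ret !(btens_liftE (ret_bal _)) linearZ.
  rewrite [tensr_map _ _](btens_liftD (map_bal _ _ l)) /ret !(btens_liftD (ret_bal _)) linearD.
  by rewrite [X in X + _]IH [X in _ + X]IH'.
have ret0 (N : lmodType R) : ret N 0 = 0.
  by apply: (addIr (ret N 0)); rewrite -[LHS](btens_liftD (ret_bal N)) !add0r.
have pure0 (N : lmodType R) : btens_pure _ _ m0 0 = 0 :> module_tens M N.
  apply: (addIr (btens_pure (fun (m : M) (r : R) => (r : R^c) *: m) (fun r (n : N) => r *: n) m0 0)).
  by rewrite -[LHS]btens_pureDr !add0r.
move=> fg n; split=> [gn0|[x <-]].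
  have /fg [t tE] : tensr_map (M := M) g (btens_pure _ _ m0 n) = 0.
    by rewrite [LHS](btens_liftE (map_bal _ _ g)) gn0.
  by exists (ret _ t); rewrite -retM tE ret1.
have /(congr1 (ret N3)) : tensr_map (M := M) g (tensr_map f (btens_pure _ _ m0 x)) = 0.
  by apply/fg; exists (btens_pure _ _ m0 x).
by rewrite !retM ret1 ret0.
Qed.
End FaithfullyFlat.

(** * Application to right coideal subalgebras *)

Section CoidealSubalgebra.
Variables (k : fieldType) (H : hopfAlgType k) (P : pred H) (A : subAlgType P).
Hypotheses (antipode_bij : bijective (@antipode k H)) (coidealA : right_coideal A).
Hypothesis fdA : finite_dimensional A.
Local Notation S := (@antipode k H).
Local Notation D := (@coproduct k H).

Let epsB := GRing.isLinear.Build k H k^o *:%R (@counit k H) (@counit_linear k H).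
Let eps : {linear H -> k^o} := HB.pack (@counit k H : H -> k^o) epsB.
Let eps1 : eps 1 = 1. Proof. exact: (@counit_monoid_morphism k H).1. Qed.

Let SB := GRing.isLinear.Build k H H *:%R S (@antipode_linear k H).
Let SL : {linear H -> H} := HB.pack S SB.

Let v : {linear A -> H} := val.

Let v1 : v 1 = 1. Proof. exact: (rmorph1 (val : {rmorphism A -> H})). Qed.

Lemma antipode1 : S 1 = 1.
Proof.
have := @antipodel k H 1; rewrite comul_monoid_morphism.1 counit_monoid_morphism.1 scale1r.
rewrite tens_liftE ?mulr1 //.
split=> [x c y y'|y c x x']; first by rewrite mulrDr -scalerAr.
by rewrite antipode_linear mulrDl -scalerAl.
Qed.

(** Since the antipode is injective and reverses products, applying it to each identity reduces the
    claim to an antipode axiom. *)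
Lemma antipode_inverse : exists S' : {linear H -> H},
  [/\ forall x y, S' (x * y) = S' y * S' x,
      forall h, \sum_(p <- D h) S' p.2 * p.1 = (counit h)%:A &
      forall h, \sum_(p <- D h) p.2 * S' p.1 = (counit h)%:A].
Proof.
case: antipode_bij => T ST TS.
have Sinj : injective S := can_inj ST.
have Tl : linear T by move=> c x y; apply: Sinj; rewrite antipode_linear !TS.
have TM x y : T (x * y) = T y * T x by apply: Sinj; rewrite antipodeM !TS.
have SA c : S c%:A = c%:A by rewrite (linear_funZ _ _ (@antipode_linear k H)) antipode1.
pose TB := GRing.isLinear.Build k H H *:%R T Tl.
pose TL : {linear H -> H} := HB.pack T TB.
exists TL; split=> [|h|h]; first exact: TM.
  apply: Sinj; rewrite SA (linear_fun_sumE _ _ (@antipode_linear k H)) -coproduct_antipodel.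
  by apply: eq_bigr => p _; rewrite antipodeM TS.
apply: Sinj; rewrite SA (linear_fun_sumE _ _ (@antipode_linear k H)) -coproduct_antipoder.
by apply: eq_bigr => p _; rewrite antipodeM TS.
Qed.

(** The coproduct of [a] comes from [A (x) H], and [v \o pi] fixes the image of [A]. *)
Lemma coideal_coproduct (pi : {linear H -> A}) : cancel v pi ->
  forall (W : lmodType k) (f : H -> H -> W) (a : A), bilinear_fun f ->
  \sum_(p <- D (v a)) f (v (pi p.1)) p.2 = \sum_(p <- D (v a)) f p.1 p.2.
Proof.
move=> piK W f a fbil; have [fr fl] := fbil.
have gbil : bilinear_fun (fun x y => f (v (pi x)) y).
  by split=> [x|y c x x']; [exact: fr | rewrite !linearP fl].
rewrite (coproduct_lift _ gbil) (coproduct_lift _ fbil).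
have [t <-] := coidealA a.
have idl : linear (idfun : H -> H) by [].
have vbil := tens_pure_bilinear (linearP v) idl.
elim/tens_ind: t => [x y|t t' IH IH'].
  by rewrite [tens_map _ _ _](tens_liftE vbil) !tens_liftE // piK.
by rewrite [tens_map _ _ _](tens_liftD vbil) !tens_liftD // [X in X + _]IH [X in _ + X]IH'.
Qed.

Lemma left_flat_right_flat :
  injective_module (A^o : lmodType A) -> left_flat_over A -> right_flat_over A.
Proof.
move=> Ainj flatA N1 N2 N3 f g fg.
have [B] := finite_dimensional_coordinates fdA.
have [C [CA C1]] := casimir_family B Ainj.
have [pi piK] := linear_left_inverse (f := v) val_inj.
have [S' [S'M S'l S'r]] := antipode_inverse.
have [b [bbil bA bv]] := flat_left_form B (linearP v) eps flatA.
have vM (x y : A) : v (x * y) = v x * v y by exact: rmorphM.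
exact: (@hopf_exact k H A v vM pi piK D eps SL S' (@coproduct_linear k H) (@coproductM k H)
  (@coproductA k H) (@coproduct_counitl k H) (@coproduct_counitr k H) eps1
  (@antipodeM k H) S'M (@coproduct_antipoder k H) S'l S'r (coideal_coproduct piK)
  b bbil bA bv B C CA C1 v1 N1 N2 N3 f g fg).
Qed.

Lemma right_flat_left_flat :
  injective_module ((A^c)^o : lmodType A^c) -> right_flat_over A -> left_flat_over A.
Proof.
move=> Ainj flatA N1 N2 N3 f g fg.
have [B] := finite_dimensional_coordinates fdA.
have [C [CA C1]] := casimir_family (A := A^c) B Ainj.
have [pi piK] := linear_left_inverse (f := v) val_inj.
have [S' [S'M S'l S'r]] := antipode_inverse.
have [b [bbil bA bv]] := flat_right_form B (linearP v) eps flatA.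
(* The opposite algebra keeps the comultiplication and has [S'] as antipode. In the call of
   [hopf_exact], [S'] and [SL] therefore trade places. *)
pose Hc : algType k := H^c; pose Ac : algType k := A^c.
pose vc : {linear Ac -> Hc} := v.
have vM (x y : Ac) : vc (x * y) = vc x * vc y by exact: (rmorphM (val : {rmorphism A -> H}) y x).
have DM (W : lmodType k) (h : Hc -> Hc -> W) (x y : Hc) : bilinear_fun h ->
    \sum_(p <- D (x * y)) h p.1 p.2 =
    \sum_(p <- D x) \sum_(q <- D y) h ((p.1 : Hc) * (q.1 : Hc)) ((p.2 : Hc) * (q.2 : Hc)).
  by move=> hbil; apply: etrans (@coproductM k H W h y x hbil) _; rewrite [LHS]exchange_big.
have SMc (x y : Hc) : SL (x * y) = (SL y : Hc) * SL x by exact: antipodeM.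
have S'Mc (x y : Hc) : S' (x * y) = (S' y : Hc) * S' x by exact: S'M.
apply: (exact_swap (l1 := fun r n => (r : A^c) *: n) (l2 := fun r n => (r : A^c) *: n)
  (l3 := fun r n => (r : A^c) *: n)) => [r n|r n|]; try exact: linearZ.
exact: (@hopf_exact k Hc Ac vc vM pi piK D eps S' SL (@coproduct_linear k H) DM (@coproductA k H)
  (@coproduct_counitl k H) (@coproduct_counitr k H) eps1
  S'Mc SMc S'l (@coproduct_antipoder k H) (@coproduct_antipodel k H)
  (coideal_coproduct piK) b bbil bA bv B C CA C1 v1 N1 N2 N3 f g fg).
Qed.

End CoidealSubalgebra.

Theorem corollary7p6 (k : fieldType) (H : hopfAlgType k)
    (antipode_bij : bijective (@antipode k H))
    (P : pred H) (A : subAlgType P)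
    (coidealA : right_coideal A)
    (fdA : finite_dimensional A) (qfA : quasi_frobenius A) :
  (left_flat_over A <-> right_flat_over A) /\
  (left_flat_over A ->
     left_faithfully_flat_over A /\ right_faithfully_flat_over A).
Proof.
have [_ [linj rinj]] := qfA.
have lr := left_flat_right_flat antipode_bij coidealA fdA linj.
have rl := right_flat_left_flat antipode_bij coidealA fdA rinj.
split; first by split.
move=> lflat; have rflat := lr lflat; pose v : {rmorphism A -> H} := val; split.
  (* Self-injectivity extends the identity of [A] along this inclusion to a retraction, which sends
     the unit of [H] to 1. *)
  pose i (a : A^o) : left_restriction v := (v a : H).
  have ilin : linear i by move=> a x y; rewrite /i rmorphD rmorphM.
  pose iB := GRing.isLinear.Build A A^o (left_restriction v) *:%R i ilin.
  pose iL : {linear A^o -> left_restriction v} := HB.pack i iB.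
  have [rho rhoK] := linj _ _ iL [the {linear A^o -> A^o} of idfun] val_inj.
  exact: (left_split_faithfully_flat (m0 := iL 1) (rhoK 1) lflat).
pose i (a : (A^c)^o) : right_restriction v := (v (a : A) : H).
have ilin : linear i by move=> a x y; rewrite /i (rmorphD v) (rmorphM v).
pose iB := GRing.isLinear.Build A^c (A^c)^o (right_restriction v) *:%R i ilin.
pose iL : {linear (A^c)^o -> right_restriction v} := HB.pack i iB.
have [rho rhoK] := rinj _ _ iL [the {linear (A^c)^o -> (A^c)^o} of idfun] val_inj.
exact: (right_split_faithfully_flat (m0 := iL 1) (rhoK 1) rflat).
Qed.
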